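(* Let $c=\sqrt{\tfrac{2(5-\sqrt5)}{15}}$ (the icosahedron case). For $\gamma\in\mathbb{R}$ let $\boldsymbol{p}_\gamma$ be the quartic patch of the context with third parameter $\gamma$ and $$\alpha=\frac{(6c^2-4)\gamma+c^2+2}{4c^2},\quad \beta=\frac{2\gamma-1}{2c^2},\quad \zeta=\frac{-4(9c^4-18c^2+8)\gamma+9c^6-24c^4-4c^2+16}{12c^2(3c^4-7c^2+4)},\quad \xi=\frac{-2(3c^4-3c^2-2)\gamma-c^2-2}{12c^2(1-c^2)},$$ and let $f_1(u,v,\gamma)=\|\boldsymbol{p}_\gamma(u,v)\|^2-1$. Put $$\gamma_1=\tfrac{1}{96}\Big(29-13\sqrt5+9\sqrt{6(5+\sqrt5)}\Big)\approx 0.617012,\qquad \gamma_2=\tfrac16\Big(-1+2\sqrt{10-2\sqrt5}\Big)\approx 0.617047.$$ Consider the system $$f_1(u,u,\gamma)=-f_1(\tfrac12,0,\gamma),\qquad \frac{\partial}{\partial u}f_1(u,u,\gamma)=0,\qquad \frac{\partial^2}{\partial u^2}f_1(u,u,\gamma)<0$$ in the unknowns $(u,\gamma)$, where a solution is called admissible if $\gamma\in[\gamma_1,\gamma_2]$, $(u,u)\in\Delta$, and $f_1(\cdot,\cdot,\gamma)$ attains its maximum over $\Delta$ at $(u,u)$. Then the only admissible solution of the system is $\gamma=\gamma_{f_1}\approx 0.617022$, $u=u^*\approx 0.139979$. Moreover, among all $G^1$-admissible quartic patches $\boldsymbol{p}$ (in the sense of the context) the simplified radial error $d_s(\boldsymbol{p})$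 attains its minimum at $\boldsymbol{p}_{\gamma_{f_1}}$.
   Context: $\Delta=\{(u,v)\in\mathbb{R}^2:\ 0\le u,v\le 1,\ v\le 1-u\}$ and $\|\cdot\|$ is the Euclidean norm. Let $\boldsymbol{v}_0=(c,0,\sqrt{1-c^2})^T$, $\boldsymbol{v}_1=(-\tfrac12c,\tfrac{\sqrt3}{2}c,\sqrt{1-c^2})^T$, $\boldsymbol{v}_2=(-\tfrac12c,-\tfrac{\sqrt3}{2}c,\sqrt{1-c^2})^T$ be the vertices of an equilateral spherical triangle on the unit sphere. The quartic patch with real parameters $\alpha,\beta,\gamma,\zeta,\xi$ is $\boldsymbol{p}:\Delta\to\mathbb{R}^3$, $\boldsymbol{p}(u,v)=\sum_{i+j+k=4}\frac{4!}{i!j!k!}u^iv^j(1-u-v)^k\,\boldsymbol{b}_{i,j,k}$ (with $i,j,k$ nonnegative integers), where $\boldsymbol{b}_{4,0,0}=\boldsymbol{v}_0$, $\boldsymbol{b}_{0,4,0}=\boldsymbol{v}_1$, $\boldsymbol{b}_{0,0,4}=\boldsymbol{v}_2$, $\boldsymbol{b}_{3,1,0}=\alpha\boldsymbol{v}_0+\beta\boldsymbol{v}_1$, $\boldsymbol{b}_{2,2,0}=\gamma(\boldsymbol{v}_0+\boldsymbol{v}_1)$, $\boldsymbol{b}_{2,1,1}=\zeta\boldsymbol{v}_0+\xi(\boldsymbol{v}_1+\boldsymbol{v}_2)$, and the remaining control points are obtained from these by symmetry, i.e. by applying the same permutation to the three index positions and to $(\boldsymbol{v}_0,\boldsymbol{v}_1,\boldsymbol{v}_2)$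 (for instance $\boldsymbol{b}_{1,3,0}=\alpha\boldsymbol{v}_1+\beta\boldsymbol{v}_0$, $\boldsymbol{b}_{0,2,2}=\gamma(\boldsymbol{v}_1+\boldsymbol{v}_2)$, $\boldsymbol{b}_{1,2,1}=\zeta\boldsymbol{v}_1+\xi(\boldsymbol{v}_0+\boldsymbol{v}_2)$). The patch is called $G^1$-admissible if: (1) it is regular: $\partial_u\boldsymbol{p}$ and $\partial_v\boldsymbol{p}$ are linearly independent at every point of $\Delta$; (2) at each of the three vertices $\boldsymbol{v}_m$ of the patch, the normal of the tangent plane of the patch is parallel to $\boldsymbol{v}_m$; (3) at every point of each of the three boundary curves of the patch, the normal $\partial_u\boldsymbol{p}\times\partial_v\boldsymbol{p}$ lies in the plane through the origin and the two endpoints of that boundary curve. Simplified radial error: $d_s(\boldsymbol{p})=\max_{(u,v)\in\Delta}\big|\|\boldsymbol{p}(u,v)\|^2-1\big|$. The symbol $\approx$ denotes a numerical value rounded to the digits shown. *)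

(* Defs.v *)
From Stdlib Require Import Reals Factorial.
From Coquelicot Require Import Coquelicot.
Open Scope R_scope.

(** * Vectors of R^3

    The vector space operations on [vec] are Coquelicot's [plus], [scal],
    [zero] and [sum_n] for the product structure on [R * R * R]. *)

Definition vec : Type := (R * R * R)%type.

Definition dot (a b : vec) : R :=
  let '(a1, a2, a3) := a in let '(b1, b2, b3) := b in
  a1 * b1 + a2 * b2 + a3 * b3.

Definition cross (a b : vec) : vec :=
  let '(a1, a2, a3) := a in let '(b1, b2, b3) := b in
  (a2 * b3 - a3 * b2, a3 * b1 - a1 * b3, a1 * b2 - a2 * b1).

Definition enorm (a : vec) : R := sqrt (dot a a).

Definition lin_indep (a b : vec) : Prop :=
  forall s t : R, plus (scal s a) (scal t b) = (zero : vec) -> s = 0 /\ t = 0.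

(** Only used for [b] nonzero. *)
Definition parallel (a b : vec) : Prop := exists s : R, a = scal s b.

(** For linearly independent [b] and [d], [a] lies in the plane through the
    origin, [b] and [d]. *)
Definition in_plane (a b d : vec) : Prop :=
  exists s t : R, a = plus (scal s b) (scal t d).

Definition Derive_vec (f : R -> vec) (x : R) : vec :=
  (Derive (fun t => fst (fst (f t))) x,
   Derive (fun t => snd (fst (f t))) x,
   Derive (fun t => snd (f t)) x).

(** * Quartic patches *)

Definition Delta (u v : R) : Prop := 0 <= u <= 1 /\ 0 <= v <= 1 /\ v <= 1 - u.

Definition v0 (c : R) : vec := (c, 0, sqrt (1 - c ^ 2)).
Definition v1 (c : R) : vec := (- (1 / 2) * c, sqrt 3 / 2 * c, sqrt (1 - c ^ 2)).
Definition v2 (c : R) : vec := (- (1 / 2) * c, - (sqrt 3 / 2) * c, sqrt (1 - c ^ 2)).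

(** Control points; the value at indices with [i + j + k <> 4] is never used. *)
Definition control_point (c alpha beta gamma zeta xi : R) (i j k : nat) : vec :=
  let near (a b : vec) := plus (scal alpha a) (scal beta b) in
  let mid (a b : vec) := scal gamma (plus a b) in
  let inner (a b d : vec) := plus (scal zeta a) (scal xi (plus b d)) in
  match i, j, k with
  | 4, 0, 0 => v0 c
  | 0, 4, 0 => v1 c
  | 0, 0, 4 => v2 c
  | 3, 1, 0 => near (v0 c) (v1 c)
  | 3, 0, 1 => near (v0 c) (v2 c)
  | 1, 3, 0 => near (v1 c) (v0 c)
  | 0, 3, 1 => near (v1 c) (v2 c)
  | 1, 0, 3 => near (v2 c) (v0 c)
  | 0, 1, 3 => near (v2 c) (v1 c)
  | 2, 2, 0 => mid (v0 c) (v1 c)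
  | 2, 0, 2 => mid (v0 c) (v2 c)
  | 0, 2, 2 => mid (v1 c) (v2 c)
  | 2, 1, 1 => inner (v0 c) (v1 c) (v2 c)
  | 1, 2, 1 => inner (v1 c) (v0 c) (v2 c)
  | 1, 1, 2 => inner (v2 c) (v0 c) (v1 c)
  | _, _, _ => (zero : vec)
  end%nat.

(** The polynomial map is defined on all of R^2, so that its partial
    derivatives make sense at the boundary of the triangle [Delta]. *)
Definition quartic_patch (c alpha beta gamma zeta xi u v : R) : vec :=
  sum_n (fun i => sum_n (fun j =>
    let k := (4 - i - j)%nat in
    scal (INR (fact 4) / (INR (fact i) * INR (fact j) * INR (fact k))
          * u ^ i * v ^ j * (1 - u - v) ^ k)
         (control_point c alpha beta gamma zeta xi i j k)) (4 - i)) 4.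

Definition patch_du (p : R -> R -> vec) (u v : R) : vec :=
  Derive_vec (fun x => p x v) u.
Definition patch_dv (p : R -> R -> vec) (u v : R) : vec :=
  Derive_vec (fun y => p u y) v.
Definition patch_normal (p : R -> R -> vec) (u v : R) : vec :=
  cross (patch_du p u v) (patch_dv p u v).

(** The parameters (1,0), (0,1), (0,0) correspond to the vertices
    [v0 c], [v1 c], [v2 c]. *)
Definition G1_admissible (c : R) (p : R -> R -> vec) : Prop :=
  (forall u v, Delta u v -> lin_indep (patch_du p u v) (patch_dv p u v)) /\
  (parallel (patch_normal p 1 0) (v0 c) /\
   parallel (patch_normal p 0 1) (v1 c) /\
   parallel (patch_normal p 0 0) (v2 c)) /\
  (forall u v, Delta u v ->
    (u + v = 1 -> in_plane (patch_normal p u v) (v0 c) (v1 c)) /\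
    (u = 0 -> in_plane (patch_normal p u v) (v1 c) (v2 c)) /\
    (v = 0 -> in_plane (patch_normal p u v) (v0 c) (v2 c))).

(** The supremum is a maximum, since the patch is continuous and [Delta] is
    compact. *)
Definition radial_error (p : R -> R -> vec) : R :=
  real (Lub_Rbar (fun e : R =>
    exists u v, Delta u v /\ e = Rabs (enorm (p u v) ^ 2 - 1))).

(** * The icosahedron case *)

Definition c_ico : R := sqrt (2 * (5 - sqrt 5) / 15).

Definition alpha_of (c g : R) : R :=
  ((6 * c ^ 2 - 4) * g + c ^ 2 + 2) / (4 * c ^ 2).
Definition beta_of (c g : R) : R :=
  (2 * g - 1) / (2 * c ^ 2).
Definition zeta_of (c g : R) : R :=
  (- 4 * (9 * c ^ 4 - 18 * c ^ 2 + 8) * g + 9 * c ^ 6 - 24 * c ^ 4 - 4 * c ^ 2 + 16)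
  / (12 * c ^ 2 * (3 * c ^ 4 - 7 * c ^ 2 + 4)).
Definition xi_of (c g : R) : R :=
  (- 2 * (3 * c ^ 4 - 3 * c ^ 2 - 2) * g - c ^ 2 - 2) / (12 * c ^ 2 * (1 - c ^ 2)).

Definition p_ico (g : R) : R -> R -> vec :=
  quartic_patch c_ico (alpha_of c_ico g) (beta_of c_ico g) g
    (zeta_of c_ico g) (xi_of c_ico g).

Definition f1 (u v g : R) : R := enorm (p_ico g u v) ^ 2 - 1.

Definition gamma1 : R := 1 / 96 * (29 - 13 * sqrt 5 + 9 * sqrt (6 * (5 + sqrt 5))).
Definition gamma2 : R := 1 / 6 * (-1 + 2 * sqrt (10 - 2 * sqrt 5)).

(** The derivatives are those of the one-variable function
    [x |-> f1 x x g]. *)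
Definition is_solution (u g : R) : Prop :=
  f1 u u g = - f1 (1 / 2) 0 g /\
  Derive (fun x => f1 x x g) u = 0 /\
  Derive_n (fun x => f1 x x g) 2 u < 0.

Definition admissible_solution (u g : R) : Prop :=
  is_solution u g /\
  gamma1 <= g <= gamma2 /\
  Delta u u /\
  (forall x y, Delta x y -> f1 x y g <= f1 u u g).

(** [r] is the value of [x] rounded to [d] decimal digits. *)
Definition rounds_to (d : nat) (x r : R) : Prop := Rabs (x - r) <= 1 / 2 * / 10 ^ d.

(* Main.v *)
Require Import Defs.
From Stdlib Require Import Reals Factorial Lra Lia List.
From Coquelicot Require Import Coquelicot.
Import ListNotations.
Open Scope R_scope.

(** Write [p = P0 v0 + P1 v1 + P2 v2]; the Gram matrix of the [v_i] has
    off-diagonal entries [sqrt 5 / 5].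

    The vertex condition fixes [alpha] in terms of [beta], and the boundary
    condition on one edge gives three equations linear in [zeta] and [xi], whose
    compatibility determinant factors: either [beta], [zeta], [xi] are the stated
    functions of [gamma], or [(beta, gamma)] lies on one of two lines, where the
    errors at the edge parameters 1/2 and 1/4 cannot both be small.

    Inside the family, [f1] is a polynomial in [s = uv + vw + wu] and
    [t = uvw] ([w = 1 - u - v]), quadratic and convex in [t].  For fixed [s] the
    largest [t], and for [s >= 1/4] the smallest, is attained on the diagonal
    [u = v], so bounding [f1] on the triangle reduces to polynomials in one
    variable.  Put [S u g = f1 u u g + f1 (1/2) 0 g] ([diag_sum] below).  In [g]
    it is a convex quadratic, negative at 0; its positive root is a continuous
    function of [u], whose minimum is [gamma_f1], attained at [u_star].  Hence
    [S _ gamma_f1 <= 0] with equality at [u_star] only.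

    Optimality: for [-1/3 - gamma_f1 < gamma < gamma_f1] the error at the edge
    midpoint exceeds the optimal value, for all other [gamma] the error at
    [(u_star, u_star)] is at least that value. *)

(** * Patches in barycentric form *)

Lemma vec_plus (a b c a' b' c' : R) :
  plus ((a, b, c) : vec) ((a', b', c') : vec) = (a + a', b + b', c + c').
Proof. reflexivity. Qed.

Lemma vec_scal (k a b c : R) :
  scal k ((a, b, c) : vec) = (k * a, k * b, k * c).
Proof. reflexivity. Qed.

Lemma vec_zero : (zero : vec) = (0, 0, 0).
Proof. reflexivity. Qed.

(** Coefficient of the vertex whose barycentric coordinate is [x]. It is symmetric in [y] and [z],
    so one formula serves all three vertices. *)
Definition weight (al be ga ze xi x y z : R) : R :=
  x ^ 4 + 4 * al * x ^ 3 * (y + z) + 4 * be * x * (y ^ 3 + z ^ 3)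
  + 6 * ga * x ^ 2 * (y ^ 2 + z ^ 2) + 12 * ze * x ^ 2 * y * z
  + 12 * xi * x * y * z * (y + z).

Definition comb (c x y z : R) : vec :=
  plus (scal x (v0 c)) (plus (scal y (v1 c)) (scal z (v2 c))).

Lemma comb_coords (c x y z : R) :
  comb c x y z =
  (c * (x - (y + z) / 2), c * sqrt 3 * (y - z) / 2,
   sqrt (1 - c ^ 2) * (x + y + z)).
Proof.
unfold comb, v0, v1, v2; rewrite !vec_scal, !vec_plus.
apply f_equal2; [apply f_equal2|]; field.
Qed.

Lemma quartic_patch_comb (c al be ga ze xi u v : R) :
  quartic_patch c al be ga ze xi u v =
  comb c (weight al be ga ze xi u v (1 - u - v))
         (weight al be ga ze xi v u (1 - u - v))
         (weight al be ga ze xi (1 - u - v) u v).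
Proof.
unfold quartic_patch.
rewrite !sum_Sn, !sum_O.
cbn [Nat.sub].
rewrite !sum_Sn, !sum_O.
cbn [Nat.sub control_point].
unfold comb, v0, v1, v2, weight.
set (r := sqrt 3); set (z := sqrt (1 - c ^ 2)).
cbn [fact Nat.mul Nat.add].
cbv beta zeta.
repeat (rewrite vec_scal || rewrite vec_plus); simpl INR.
apply f_equal2; [apply f_equal2|]; field.
Qed.

(** [weight_x] and [weight_y] are partial derivatives of [weight]; by symmetry the one in [z] is
    [weight_y] with its last two arguments exchanged. *)
Definition weight_x (al be ga ze xi x y z : R) : R :=
  4 * x ^ 3 + 12 * al * x ^ 2 * (y + z) + 4 * be * (y ^ 3 + z ^ 3)
  + 12 * ga * x * (y ^ 2 + z ^ 2) + 24 * ze * x * y * z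
  + 12 * xi * y * z * (y + z).

Definition weight_y (al be ga ze xi x y z : R) : R :=
  4 * al * x ^ 3 + 12 * be * x * y ^ 2 + 12 * ga * x ^ 2 * y
  + 12 * ze * x ^ 2 * z + 12 * xi * x * z * (2 * y + z).

Lemma patch_du_comb (c al be ga ze xi u v : R) (w := 1 - u - v) :
  patch_du (quartic_patch c al be ga ze xi) u v =
  comb c (weight_x al be ga ze xi u v w - weight_y al be ga ze xi u w v)
         (weight_y al be ga ze xi v u w - weight_y al be ga ze xi v w u)
         (weight_y al be ga ze xi w u v - weight_x al be ga ze xi w u v).
Proof.
rewrite comb_coords; unfold patch_du, Derive_vec.
apply f_equal2; [apply f_equal2|]; apply is_derive_unique;
  (eapply is_derive_ext;
    [intro t; rewrite quartic_patch_comb, comb_coords; reflexivity|]);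
  unfold weight, w; cbn [fst snd];
  try generalize (sqrt (1 - c ^ 2)); intros;
  (auto_derive; [exact I | unfold weight_x, weight_y; field]).
Qed.

Lemma patch_dv_comb (c al be ga ze xi u v : R) (w := 1 - u - v) :
  patch_dv (quartic_patch c al be ga ze xi) u v =
  comb c (weight_y al be ga ze xi u v w - weight_y al be ga ze xi u w v)
         (weight_x al be ga ze xi v u w - weight_y al be ga ze xi v w u)
         (weight_y al be ga ze xi w v u - weight_x al be ga ze xi w u v).
Proof.
rewrite comb_coords; unfold patch_dv, Derive_vec.
apply f_equal2; [apply f_equal2|]; apply is_derive_unique;
  (eapply is_derive_ext;
    [intro t; rewrite quartic_patch_comb, comb_coords; reflexivity|]);
  unfold weight, w; cbn [fst snd];
  try generalize (sqrt (1 - c ^ 2)); intros;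
  (auto_derive; [exact I | unfold weight_x, weight_y; field]).
Qed.

(** * Inner products of combinations of the vertices *)

Definition q5 : R := sqrt 5.

Lemma q5_sqr : q5 ^ 2 = 5.
Proof. unfold q5; rewrite <- Rsqr_pow2; apply Rsqr_sqrt; lra. Qed.

Lemma q5_bounds :
  22360679774997896964091736 / 10 ^ 25 < q5 < 22360679774997896964091737 / 10 ^ 25.
Proof.
assert (H := q5_sqr); assert (H0 : 0 <= q5) by apply sqrt_pos.
split; apply Rnot_le_lt; intro Hc.
- assert (q5 ^ 2 <= (22360679774997896964091736 / 10 ^ 25) ^ 2)
    by (apply pow_incr; lra); lra.
- assert ((22360679774997896964091737 / 10 ^ 25) ^ 2 <= q5 ^ 2)
    by (apply pow_incr; lra); lra.
Qed.

Lemma c_ico_sqr : c_ico ^ 2 = 2 * (5 - q5) / 15.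
Proof.
assert (H := q5_bounds).
unfold c_ico; fold q5; rewrite <- Rsqr_pow2; apply Rsqr_sqrt; lra.
Qed.

Lemma c_ico_pos : 0 < c_ico.
Proof.
assert (H := q5_bounds); unfold c_ico; fold q5; apply sqrt_lt_R0; lra.
Qed.

Lemma sqrt3_sqr : sqrt 3 ^ 2 = 3.
Proof. rewrite <- Rsqr_pow2; apply Rsqr_sqrt; lra. Qed.

Lemma height_sqr : sqrt (1 - c_ico ^ 2) ^ 2 = (5 + 2 * q5) / 15.
Proof.
assert (H := q5_bounds).
rewrite <- Rsqr_pow2, Rsqr_sqrt; rewrite c_ico_sqr; lra.
Qed.

(** The vertices are unit vectors with pairwise inner product [1 - 3 / 2 * c ^ 2], which is [q5 / 5]
    for the icosahedron. *)
Lemma dot_comb (x y z x' y' z' : R) :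
  dot (comb c_ico x y z) (comb c_ico x' y' z') =
  x * x' + y * y' + z * z'
  + q5 / 5 * (x * (y' + z') + y * (x' + z') + z * (x' + y')).
Proof.
rewrite !comb_coords; unfold dot.
replace (_ + _ + _) with
  (c_ico ^ 2 * ((x - (y + z) / 2) * (x' - (y' + z') / 2)
     + sqrt 3 ^ 2 * ((y - z) / 2 * ((y' - z') / 2)))
   + sqrt (1 - c_ico ^ 2) ^ 2 * ((x + y + z) * (x' + y' + z'))) by field.
rewrite sqrt3_sqr, height_sqr, c_ico_sqr; field.
Qed.

(** * Sign of a polynomial on an interval *)

Fixpoint peval (p : list R) (x : R) : R :=
  match p with
  | [] => 0
  | a :: p => a + x * peval p x
  end.

Fixpoint pderiv_from (k : R) (p : list R) : list R :=
  match p with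
  | [] => []
  | a :: p => k * a :: pderiv_from (k + 1) p
  end.

Definition pderiv (p : list R) : list R := pderiv_from 1 (tl p).

(** Quotient by [X - a]; the remainder is [peval p a]. *)
Fixpoint pquot (a : R) (p : list R) : list R :=
  match p with
  | [] => []
  | _ :: p => peval p a :: pquot a p
  end.

Lemma peval_pquot (a x : R) (p : list R) :
  peval p x = peval p a + (x - a) * peval (pquot a p) x.
Proof.
induction p as [|b p IH]; simpl; [ring|].
rewrite IH at 1; ring.
Qed.

(** For [k = 2] this is the product rule for [x * p], the induction step of [is_derive_peval]. *)
Lemma peval_pderiv_from (k : R) (p : list R) (x : R) :
  peval (pderiv_from k p) x = (k - 1) * peval p x + peval (pderiv_from 1 p) x.
Proof.
revert k; induction p as [|a p IH]; intro k; simpl; [ring|].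
rewrite (IH (k + 1)), (IH (1 + 1)); ring.
Qed.

Lemma is_derive_peval (p : list R) (x : R) :
  is_derive (peval p) x (peval (pderiv p) x).
Proof.
induction p as [|a p IH].
- apply (is_derive_const 0).
- change (is_derive (fun x => a + x * peval p x) x (peval (pderiv (a :: p)) x)).
  auto_derive; [eexists; exact IH|].
  replace (Derive _ x) with (peval (pderiv p) x)
    by (symmetry; apply is_derive_unique; exact IH).
  unfold pderiv; destruct p as [|b p]; simpl; [ring|].
  rewrite (peval_pderiv_from (1 + 1)); ring.
Qed.

Lemma ex_derive_peval (p : list R) (x : R) : ex_derive (peval p) x.
Proof. exists (peval (pderiv p) x); apply is_derive_peval. Qed.

(** Binary forms [sum_i c_i X^(n-i) Y^i] as coefficient lists. *)
Fixpoint hmul (a b : R) (prev : R) (p : list R) : list R :=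
  match p with
  | [] => [b * prev]
  | c :: p => (a * c + b * prev) :: hmul a b c p
  end.

Fixpoint hadd (k : R) (p q : list R) : list R :=
  match p, q with
  | a :: p, b :: q => (k * a + b) :: hadd k p q
  | _, _ => q
  end.

Fixpoint hpow_sum (n : nat) : list R :=
  match n with
  | O => [1]
  | S n => hmul 1 1 0 (hpow_sum n)
  end.

(** The substitution [u := (a X + b Y) / (X + Y)], cleared of denominators:
    the coefficients are Bernstein coefficients on [a, b] up to binomials. *)
Fixpoint bernstein (a b : R) (p : list R) : list R :=
  match p with
  | [] => []
  | [c] => [c]
  | c :: p => hadd c (hpow_sum (length p)) (hmul a b 0 (bernstein a b p))
  end.

Fixpoint heval (p : list R) (x y : R) : R :=
  match p with
  | [] => 0
  | c :: p => c * x ^ length p + y * heval p x y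
  end.

Lemma length_hmul (a b prev : R) (p : list R) :
  length (hmul a b prev p) = S (length p).
Proof. revert prev; induction p; intro prev; simpl; auto. Qed.

Lemma heval_hmul (a b prev x y : R) (p : list R) :
  heval (hmul a b prev p) x y =
  (a * x + b * y) * heval p x y + b * prev * x ^ length p.
Proof.
revert prev; induction p as [|c p IH]; intro prev; simpl; [ring|].
rewrite length_hmul, IH; simpl; ring.
Qed.

Lemma length_hpow_sum (n : nat) : length (hpow_sum n) = S n.
Proof. induction n; simpl; auto; rewrite length_hmul; auto. Qed.

Lemma heval_hpow_sum (n : nat) (x y : R) :
  heval (hpow_sum n) x y = (x + y) ^ n.
Proof.
induction n; simpl; [ring|]; rewrite heval_hmul, IHn; ring.
Qed.

Lemma length_hadd (k : R) (p q : list R) : length (hadd k p q) = length q.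
Proof. revert q; induction p; intros [|b q]; simpl; auto. Qed.

Lemma heval_hadd (k x y : R) (p q : list R) :
  length p = length q ->
  heval (hadd k p q) x y = k * heval p x y + heval q x y.
Proof.
revert q; induction p as [|a p IH]; intros [|b q] H; try discriminate; simpl;
  [ring|].
injection H as H; rewrite length_hadd, IH, H by assumption; ring.
Qed.

Lemma length_bernstein (a b : R) (p : list R) :
  length (bernstein a b p) = length p.
Proof.
induction p as [|c [|d p] IH]; auto.
change (bernstein a b (c :: d :: p)) with
  (hadd c (hpow_sum (length (d :: p))) (hmul a b 0 (bernstein a b (d :: p)))).
rewrite length_hadd, length_hmul, IH; reflexivity.
Qed.

Lemma heval_bernstein (a b x y : R) (p : list R) :
  x + y = 1 -> heval (bernstein a b p) x y = peval p (a * x + b * y).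
Proof.
intro H; induction p as [|c [|d p] IH]; [reflexivity|simpl; ring|].
change (bernstein a b (c :: d :: p)) with
  (hadd c (hpow_sum (length (d :: p))) (hmul a b 0 (bernstein a b (d :: p)))).
rewrite heval_hadd, heval_hpow_sum, heval_hmul, IH, H, pow1.
- change (peval (c :: d :: p) (a * x + b * y))
    with (c + (a * x + b * y) * peval (d :: p) (a * x + b * y)); ring.
- rewrite length_hpow_sum, length_hmul, length_bernstein; reflexivity.
Qed.

Fixpoint all_neg (p : list R) : Prop :=
  match p with
  | [] => True
  | c :: p => c < 0 /\ all_neg p
  end.

(** All monomials are nonnegative. Strictness comes from the first coefficient if [x > 0], and from
    the last one if [x = 0], where [y = 1]. *)
Lemma heval_neg (p : list R) (x y : R) :
  p <> [] -> all_neg p -> 0 <= x -> 0 <= y -> x + y = 1 -> heval p x y < 0.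
Proof.
intros Hp Hn Hx Hy Hs.
assert (Hle : forall q, all_neg q -> heval q x y <= 0).
{ induction q as [|c q IH]; simpl; [lra|]; intros [Hc Hq].
  assert (0 <= x ^ length q) by (apply pow_le; auto).
  specialize (IH Hq); nra. }
destruct (Req_dec x 0) as [Hx0|Hx0].
- assert (y = 1) by lra; subst; clear - Hp Hn.
  induction p as [|c p IH]; [congruence|].
  destruct Hn as [Hc Hn]; destruct p as [|d p]; [simpl; lra|].
  change (c * 0 ^ length (d :: p) + 1 * heval (d :: p) 0 1 < 0).
  simpl length; rewrite pow_i by lia.
  assert (heval (d :: p) 0 1 < 0) by (apply IH; auto; congruence); lra.
- destruct p as [|c p]; [congruence|]; destruct Hn as [Hc Hn]; simpl.
  assert (0 < x ^ length p) by (apply pow_lt; lra).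
  specialize (Hle p Hn); nra.
Qed.

Lemma bernstein_neg (a b : R) (p : list R) (u : R) :
  a < b -> a <= u <= b -> p <> [] -> all_neg (bernstein a b p) ->
  peval p u < 0.
Proof.
intros Hab Hu Hp Hn.
replace u with (a * ((b - u) / (b - a)) + b * ((u - a) / (b - a)))
  by (field; lra).
rewrite <- heval_bernstein by (field; lra).
apply heval_neg; auto.
- intro E; apply (f_equal (@length R)) in E; rewrite length_bernstein in E.
  destruct p; [congruence|discriminate].
- apply Rmult_le_pos; [lra|left; apply Rinv_0_lt_compat; lra].
- apply Rmult_le_pos; [lra|left; apply Rinv_0_lt_compat; lra].
- field; lra.
Qed.

(** * The radial error as a polynomial in [uv + vw + wu] and [uvw] *)

(** The four parameter functions at [c_ico], with denominators rationalized in Q(sqrt 5). *)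
Definition al_ico (g : R) : R := (19 + 3 * q5 - 6 * (1 + q5) * g) / 16.
Definition be_ico (g : R) : R := 3 / 16 * (5 + q5) * (2 * g - 1).
Definition ze_ico (g : R) : R := (-13 + 11 * q5 + (30 - 18 * q5) * g) / 8.
Definition xi_ico (g : R) : R := (-65 + 23 * q5 + (98 - 30 * q5) * g) / 16.

Lemma Rdiv_eq_intro (x y z : R) : y <> 0 -> x = z * y -> x / y = z.
Proof. intros Hy ->; field; exact Hy. Qed.

Lemma ico_parameters (g : R) :
  alpha_of c_ico g = al_ico g /\ beta_of c_ico g = be_ico g /\
  zeta_of c_ico g = ze_ico g /\ xi_of c_ico g = xi_ico g.
Proof.
assert (H := q5_bounds). assert (Hq := q5_sqr).
unfold alpha_of, beta_of, zeta_of, xi_of, al_ico, be_ico, ze_ico, xi_ico.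
replace (c_ico ^ 6) with ((c_ico ^ 2) ^ 3) by ring.
replace (c_ico ^ 4) with ((c_ico ^ 2) ^ 2) by ring.
rewrite c_ico_sqr.
assert (H1 : 12 * (2 * (5 - q5) / 15) * (1 - 2 * (5 - q5) / 15) <> 0)
  by (apply Rgt_not_eq; nra).
assert (H2 : 3 * (2 * (5 - q5) / 15) ^ 2 - 7 * (2 * (5 - q5) / 15) + 4 =
             (14 + 6 * q5) / 15) by (field_simplify_eq; ring [Hq]).
rewrite H2.
repeat split; apply Rdiv_eq_intro; try nra; field_simplify_eq; ring [Hq].
Qed.

Lemma enorm_sqr (a : vec) : enorm a ^ 2 = dot a a.
Proof.
unfold enorm; rewrite <- Rsqr_pow2, Rsqr_sqrt; auto.
destruct a as [[x y] z]; simpl; nra.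
Qed.

Definition gram (x y z : R) : R :=
  x ^ 2 + y ^ 2 + z ^ 2 + 2 * q5 / 5 * (x * y + y * z + z * x).

Lemma enorm_comb (x y z : R) : enorm (comb c_ico x y z) ^ 2 = gram x y z.
Proof. rewrite enorm_sqr, dot_comb; unfold gram; field. Qed.

(** [eij g] is the coefficient of [s^i t^j]. *)
Definition e20 (g : R) : R :=
  3 / 2 + 9 / 2 * q5 - (42 + 78 / 5 * q5) * g + (54 + 18 * q5) * g ^ 2.
Definition e30 (g : R) : R :=
  - 68 - 88 / 5 * q5 + (192 + 336 / 5 * q5) * g - (144 + 288 / 5 * q5) * g ^ 2.
Definition e01 (g : R) : R :=
  15 / 2 - 21 / 2 * q5 + (66 + 18 * q5) * g - (90 + 18 * q5) * g ^ 2.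
Definition e11 (g : R) : R :=
  153 + 39 * q5 - (564 + 588 / 5 * q5) * g + (468 + 108 * q5) * g ^ 2.
Definition e21 (g : R) : R :=
  - 348 + 228 / 5 * q5 + (720 + 144 / 5 * q5) * g
  - (432 + 432 / 5 * q5) * g ^ 2.
Definition e02 (g : R) : R :=
  1683 - 624 * q5 - (4176 - 7236 / 5 * q5) * g + (2700 - 864 * q5) * g ^ 2.
Definition e12 (g : R) : R :=
  - 954 + 1818 / 5 * q5 + (1512 - 2376 / 5 * q5) * g
  - (648 - 648 / 5 * q5) * g ^ 2.

Definition err (g s t : R) : R :=
  e20 g * s ^ 2 + e30 g * s ^ 3 + (e01 g + e11 g * s + e21 g * s ^ 2) * t
  + (e02 g + e12 g * s) * t ^ 2.

Lemma f1_gram (u v g : R) (w := 1 - u - v)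
    (wt := weight (al_ico g) (be_ico g) g (ze_ico g) (xi_ico g)) :
  f1 u v g = gram (wt u v w) (wt v u w) (wt w u v) - 1.
Proof.
unfold f1, p_ico.
destruct (ico_parameters g) as (-> & -> & -> & ->).
rewrite quartic_patch_comb, enorm_comb; reflexivity.
Qed.

(** A symmetric polynomial in barycentric coordinates of sum 1 is a polynomial in [s] and [t]. Of
    the monomials of degree at most 8 in the coordinates, 1, [s] and [s ^ 4] drop out. *)
Lemma f1_err (u v g : R) :
  f1 u v g =
  err g (u * v + (u + v) * (1 - u - v)) (u * v * (1 - u - v)).
Proof.
rewrite f1_gram.
assert (Hq := q5_sqr).
unfold gram, weight, err, al_ico, be_ico, ze_ico, xi_ico,
  e20, e30, e01, e11, e21, e02, e12.
field_simplify_eq.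
ring [Hq].
Qed.

(** * Enclosures on the diagonal *)

Definition mid (g : R) : R := e20 g / 16 + e30 g / 64.

(** Comes from substituting [s = u * (2 - 3 * u)] and [t = u ^ 2 * (1 - 2 * u)], the values on the
    diagonal [u = v]. *)
Definition diag (k g : R) : list R :=
  [k; 0; 4 * e20 g + e01 g; - 12 * e20 g + 8 * e30 g - 2 * e01 g + 2 * e11 g;
   9 * e20 g - 36 * e30 g - 7 * e11 g + 4 * e21 g + e02 g;
   54 * e30 g + 6 * e11 g - 20 * e21 g - 4 * e02 g + 2 * e12 g;
   - 27 * e30 g + 33 * e21 g + 4 * e02 g - 11 * e12 g;
   - 18 * e21 g + 20 * e12 g; - 12 * e12 g].

Definition diag_sum (g : R) : list R := diag (mid g) g.

Lemma peval_diag (k g u : R) :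
  peval (diag k g) u = k + err g (u * (2 - 3 * u)) (u ^ 2 * (1 - 2 * u)).
Proof. unfold diag, peval, err; ring. Qed.

Lemma f1_diag (u g : R) : f1 u u g = peval (diag 0 g) u.
Proof. rewrite peval_diag, f1_err, Rplus_0_l; f_equal; ring. Qed.

Lemma f1_mid (g : R) : f1 (1 / 2) 0 g = mid g.
Proof. rewrite f1_err; unfold err, mid; field. Qed.

Lemma peval_diag_sum (g u : R) : peval (diag_sum g) u = peval (diag 0 g) u + mid g.
Proof. unfold diag_sum; rewrite !peval_diag; ring. Qed.

(** The coefficients of [g ^ 2] and [g] are recovered as second and first central differences at -1,
    0, 1. The first is kept as a list so that the Bernstein test applies to it. *)
Definition quad_coeff : list R := 
  hadd (1 / 2) (diag_sum 1) (hadd (1 / 2) (diag_sum (-1)) (map Ropp (diag_sum 0))).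
Definition lin_coeff (u : R) : R :=
  (peval (diag_sum 1) u - peval (diag_sum (-1)) u) / 2.

Lemma peval_quad_coeff (u : R) :
  peval quad_coeff u =
  (peval (diag_sum 1) u + peval (diag_sum (-1)) u) / 2 - peval (diag_sum 0) u.
Proof. unfold quad_coeff, diag_sum, diag; cbn [hadd peval map]; field. Qed.

Lemma peval_F_quadratic (g u : R) :
  peval (diag_sum g) u =
  peval quad_coeff u * g ^ 2 + lin_coeff u * g + peval (diag_sum 0) u.
Proof.
rewrite peval_quad_coeff; unfold lin_coeff, diag_sum; rewrite !peval_diag.
unfold err, mid, e20, e30, e01, e11, e21, e02, e12; field.
Qed.

(** The coefficients [eij g] stay atomic in the goal: expanding them in place
    would multiply the size of every Bernstein coefficient. *)
Ltac expand_coefficients :=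
  repeat match goal with
  | |- context [?e ?g] =>
      match e with
      | e20 => idtac | e30 => idtac | e01 => idtac | e11 => idtac
      | e21 => idtac | e02 => idtac | e12 => idtac
      end;
      let x := fresh "x" in let E := fresh "E" in
      remember (e g) as x eqn:E; unfold e in E; field_simplify in E
  end.

Ltac bernstein_numeric a b :=
  apply (bernstein_neg a b); [lra | lra | discriminate |];
  unfold quad_coeff, diag_sum, diag;
  cbn [bernstein all_neg hmul hadd hpow_sum length map
    pderiv pderiv_from tl pquot peval];
  unfold mid; expand_coefficients;
  repeat split; lra.

Lemma diag_sum_0_neg (u : R) : 0 <= u <= 1 / 2 -> peval (diag_sum 0) u < 0.
Proof.
intro Hu; assert (Hq := q5_bounds).
bernstein_numeric 0 (1 / 2).
Qed.

Lemma quad_coeff_pos (u : R) : 0 <= u <= 1 / 2 -> 0 < peval quad_coeff u.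
Proof.
intro Hu; assert (Hq := q5_bounds).
cut (peval (map Ropp quad_coeff) u < 0).
- unfold quad_coeff, diag_sum, diag; cbn [map hadd peval]; lra.
- bernstein_numeric 0 (1 / 2).
Qed.

(** Enclosure of [gamma_f1], tight enough to locate [u_star] to 6 digits. *)
Definition g_lo : R := 6170221971 / 10 ^ 10.
Definition g_hi : R := 6170221972 / 10 ^ 10.
Definition u_0 : R := 139979 / 10 ^ 6.


(** One positive sample puts the root at [u_0], and hence the minimal root over all [u], below
    [g_hi]. *)
Lemma diag_sum_hi_u_0 : 0 < peval (diag_sum g_hi) u_0.
Proof.
assert (Hq := q5_bounds).
unfold u_0, g_hi, diag_sum, diag; cbn [peval]; unfold mid; expand_coefficients; lra.
Qed.

(** Writes [g = g_lo + d] and bounds the monomials [d ^ 2], [q5 * d] and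
    [q5 * d ^ 2], so that [lra] can decide polynomial inequalities in [q5] and
    [g]. *)
Ltac center_gamma g :=
  assert (Hq := q5_bounds);
  let d := fresh "d" in let Ed := fresh "Ed" in
  remember (g - g_lo) as d eqn:Ed;
  assert (0 <= d <= / 10 ^ 10) by (unfold g_lo, g_hi in *; lra);
  replace g with (6170221971 / 10 ^ 10 + d) by (unfold g_lo in Ed; lra);
  assert (0 <= d ^ 2 <= / 10 ^ 10 * d) by nra;
  assert (0 <= (q5 - 22360679774997896964091736 / 10 ^ 25) * d)
    by (apply Rmult_le_pos; lra);
  assert (0 <= (22360679774997896964091737 / 10 ^ 25 - q5) * d)
    by (apply Rmult_le_pos; lra);
  assert (0 <= (q5 - 22360679774997896964091736 / 10 ^ 25) * d ^ 2)
    by (apply Rmult_le_pos; lra);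
  assert (0 <= (22360679774997896964091737 / 10 ^ 25 - q5) * d ^ 2)
    by (apply Rmult_le_pos; lra).

(** The sum nearly has a double zero close to [u_0], where a direct sign test would fail; on
    [[3/25, 4/25]] concavity takes its place. *)
Lemma diag_sum_outside_neg (g u : R) :
  g_lo <= g <= g_hi -> 0 <= u <= 3 / 25 \/ 4 / 25 <= u <= 1 / 2 ->
  peval (diag_sum g) u < 0.
Proof.
intros Hg Hu; center_gamma g; destruct Hu as [Hu|Hu].
- bernstein_numeric 0 (3 / 25).
- bernstein_numeric (4 / 25) (1 / 2).
Qed.

Lemma diag_sum_second_derivative_neg (g u : R) :
  g_lo <= g <= g_hi -> 3 / 25 <= u <= 4 / 25 ->
  peval (pderiv (pderiv (diag_sum g))) u < 0.
Proof.
intros Hg Hu; center_gamma g.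
bernstein_numeric (3 / 25) (4 / 25).
Qed.

(** The tangent at [u_0] is almost horizontal, and the sign change half a unit of the sixth decimal
    away on either side locates the critical point. *)
Lemma diag_sum_derivative_u_0 (g : R) :
  g_lo <= g <= g_hi ->
  - 2 / 10 ^ 9 < peval (pderiv (diag_sum g)) u_0 < 2 / 10 ^ 9 /\
  0 < peval (pderiv (diag_sum g)) (u_0 - / 2 * / 10 ^ 6) /\
  peval (pderiv (diag_sum g)) (u_0 + / 2 * / 10 ^ 6) < 0.
Proof.
intros Hg; center_gamma g.
unfold u_0, diag_sum, diag; cbn [peval pderiv pderiv_from tl];
expand_coefficients; repeat split; lra.
Qed.

Lemma peval_MVT (p : list R) (x y : R) :
  x < y -> exists z, x < z < y /\ peval p y - peval p x = peval (pderiv p) z * (y - x).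
Proof.
intro H.
destruct (MVT_cor2 (peval p) (peval (pderiv p)) x y H) as (z & E & Hz).
- intros c _; apply is_derive_Reals, is_derive_peval.
- exists z; auto.
Qed.

Lemma peval_below_tangent (p : list R) (a b x y : R) :
  (forall z, a <= z <= b -> peval (pderiv (pderiv p)) z < 0) ->
  a <= x <= b -> a <= y <= b ->
  peval p y <= peval p x + peval (pderiv p) x * (y - x).
Proof.
intros Hneg Hx Hy.
destruct (Rtotal_order x y) as [H|[<-|H]]; [|lra|].
- destruct (peval_MVT p x y H) as (z & Hz & E).
  destruct (peval_MVT (pderiv p) x z) as (t & Ht & E'); [lra|].
  assert (Hn : peval (pderiv (pderiv p)) t < 0) by (apply Hneg; lra).
  assert (peval (pderiv p) z < peval (pderiv p) x) by nra; nra.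
- destruct (peval_MVT p y x H) as (z & Hz & E).
  destruct (peval_MVT (pderiv p) z x) as (t & Ht & E'); [lra|].
  assert (Hn : peval (pderiv (pderiv p)) t < 0) by (apply Hneg; lra).
  assert (peval (pderiv p) x < peval (pderiv p) z) by nra; nra.
Qed.

(** On the middle interval the graph lies below its tangent at [u_0], which rises by at most
    [2 / 10 ^ 9 * 21 / 1000], less than the depth [/ 10 ^ 10] at [u_0]. *)
Lemma diag_sum_lo_neg (u : R) : 0 <= u <= 1 / 2 -> peval (diag_sum g_lo) u < 0.
Proof.
assert (Hq := q5_bounds); intro Hu.
assert (Hg : g_lo <= g_lo <= g_hi) by (unfold g_lo, g_hi; lra).
destruct (Rle_lt_dec u (3 / 25)) as [H1|H1];
  [apply diag_sum_outside_neg; lra|].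
destruct (Rle_lt_dec (4 / 25) u) as [H2|H2];
  [apply diag_sum_outside_neg; lra|].
assert (E0 : peval (diag_sum g_lo) u_0 < - / 10 ^ 10).
{ unfold g_lo, u_0, diag_sum, diag; cbn [peval];
  unfold mid; expand_coefficients; lra. }
assert (Ht := peval_below_tangent (diag_sum g_lo) (3 / 25) (4 / 25) u_0 u
  (fun z => diag_sum_second_derivative_neg g_lo z Hg)).
destruct (diag_sum_derivative_u_0 g_lo Hg) as [Hd _].
assert (H : 3 / 25 <= u_0 <= 4 / 25) by (unfold u_0; lra).
specialize (Ht H (conj (Rlt_le _ _ H1) (Rlt_le _ _ H2))).
assert (- 21 / 1000 <= u - u_0 <= 21 / 1000) by (unfold u_0; lra).
nra.
Qed.

(** * The optimal parameter *)

Definition pos_root (a b c : R) : R := (- b + sqrt (b ^ 2 - 4 * a * c)) / (2 * a).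

(** The roots have opposite signs, and [k] is [a] times the distance from [g] to the negative
    one. *)
Lemma pos_root_spec (a b c g : R) (r := pos_root a b c) :
  0 < a -> c < 0 ->
  0 < r /\ exists k, (0 <= g -> 0 < k) /\ a * g ^ 2 + b * g + c = (g - r) * k.
Proof.
intros Ha Hc.
assert (Hs : sqrt (b ^ 2 - 4 * a * c) ^ 2 = b ^ 2 - 4 * a * c)
  by (rewrite <- Rsqr_pow2; apply Rsqr_sqrt; nra).
assert (Hs0 := sqrt_pos (b ^ 2 - 4 * a * c)).
set (s := sqrt (b ^ 2 - 4 * a * c)) in *.
assert (Hr : 2 * a * r = s - b)
  by (unfold r, pos_root; fold s; field; lra).
assert (Hsb : Rabs b < s).
{ apply Rnot_le_lt; intro H.
  assert (s ^ 2 <= b ^ 2); [|nra].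
  rewrite (pow2_abs b) at 1 || rewrite <- (pow2_abs b).
  apply pow_incr; lra. }
apply Rabs_def2 in Hsb.
split; [nra|].
exists (a * g + (s + b) / 2); split; [intro; nra|].
replace c with ((b ^ 2 - s ^ 2) / (4 * a)) by (rewrite Hs; field; lra).
replace r with ((s - b) / (2 * a)) by (rewrite <- Hr; field; lra).
field; lra.
Qed.

Lemma continuous_pos_root (a b c : R -> R) (u : R) :
  ex_derive a u -> ex_derive b u -> ex_derive c u -> 0 < a u -> c u < 0 ->
  continuity_pt (fun x => pos_root (a x) (b x) (c x)) u.
Proof.
intros Da Db Dc Ha Hc.
apply derivable_continuous_pt, ex_derive_Reals_0.
unfold pos_root; auto_derive; repeat split; auto; nra.
Qed.

Definition root_of_diag_sum (u : R) : R :=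
  pos_root (peval quad_coeff u) (lin_coeff u) (peval (diag_sum 0) u).

Lemma diag_sum_sign (u g : R) :
  0 <= u <= 1 / 2 -> 0 <= g ->
  exists k, 0 < k /\ peval (diag_sum g) u = (g - root_of_diag_sum u) * k.
Proof.
intros Hu Hg.
destruct (pos_root_spec (peval quad_coeff u) (lin_coeff u) (peval (diag_sum 0) u) g
  (quad_coeff_pos u Hu) (diag_sum_0_neg u Hu)) as (_ & k & Hk & E).
exists k; split; [auto|]; rewrite peval_F_quadratic; exact E.
Qed.

Lemma continuous_root_of_diag_sum (u : R) :
  0 <= u <= 1 / 2 -> continuity_pt root_of_diag_sum u.
Proof.
intro Hu.
apply (continuous_pos_root (peval quad_coeff) lin_coeff (peval (diag_sum 0)));
  [apply ex_derive_peval | | apply ex_derive_peval | apply quad_coeff_pos, Hu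
  | apply diag_sum_0_neg, Hu].
apply (ex_derive_ext
  (fun x => plus (scal (/ 2) (peval (diag_sum 1) x))
    (scal (- / 2) (peval (diag_sum (-1)) x)))).
- intro t; unfold lin_coeff, plus, scal, mult; simpl; unfold mult; simpl; field.
- apply (ex_derive_plus (V := R_NormedModule));
    apply ex_derive_scal, ex_derive_peval.
Qed.

Lemma exists_critical_pair :
  exists u g, 0 <= u <= 1 / 2 /\ g_lo < g < g_hi /\
    peval (diag_sum g) u = 0 /\ forall x, 0 <= x <= 1 / 2 -> peval (diag_sum g) x <= 0.
Proof.
destruct (continuity_ab_min root_of_diag_sum 0 (1 / 2)) as (u & Hmin & Hu);
  [lra | intros; apply continuous_root_of_diag_sum; auto |].
assert (H0 : 0 < root_of_diag_sum u)
  by (apply pos_root_spec; [exact 0 | apply quad_coeff_pos | apply diag_sum_0_neg]; auto).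
exists u, (root_of_diag_sum u).
split; [auto|]. split; [split|split].
- destruct (diag_sum_sign u g_lo Hu) as (k & Hk & E); [unfold g_lo; lra|].
  assert (H := diag_sum_lo_neg u Hu); nra.
- assert (Hu0 : 0 <= u_0 <= 1 / 2) by (unfold u_0; lra).
  destruct (diag_sum_sign u_0 g_hi Hu0) as (k & Hk & E); [unfold g_hi; lra|].
  assert (H := diag_sum_hi_u_0). assert (H' := Hmin u_0 Hu0); nra.
- destruct (diag_sum_sign u (root_of_diag_sum u) Hu) as (k & Hk & E); [lra|].
  rewrite E; ring.
- intros x Hx; destruct (diag_sum_sign x (root_of_diag_sum u) Hx) as (k & Hk & E); [lra|].
  assert (H' := Hmin x Hx); rewrite E; nra.
Qed.

Lemma pderiv_diag_sum (g : R) : pderiv (diag_sum g) = pderiv (diag 0 g).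
Proof. reflexivity. Qed.

Lemma peval_interior_max (p : list R) (a b x : R) :
  a < x < b -> (forall y, a <= y <= b -> peval p y <= peval p x) ->
  peval (pderiv p) x = 0.
Proof.
intros Hx Hmax.
assert (D : derivable_pt_lim (peval p) x (peval (pderiv p) x))
  by apply is_derive_Reals, is_derive_peval.
rewrite <- (derive_pt_eq_0 (peval p) x _ (exist _ _ D) D).
apply (deriv_maximum (peval p) a b x (exist _ _ D)); try apply Hx.
intros y H1 H2; apply Hmax; lra.
Qed.

Lemma diag_sum_zero_location (g u : R) :
  g_lo <= g <= g_hi ->
  (forall x, 0 <= x <= 1 / 2 -> peval (diag_sum g) x <= 0) ->
  0 <= u <= 1 / 2 -> peval (diag_sum g) u = 0 ->
  3 / 25 <= u <= 4 / 25 /\ peval (pderiv (diag_sum g)) u = 0.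
Proof.
intros Hg Hmax Hu H0.
assert (H1 : 3 / 25 < u < 4 / 25).
{ split; apply Rnot_le_lt; intro H; apply (Rlt_irrefl 0);
    rewrite <- H0 at 1; apply diag_sum_outside_neg; lra. }
split; [lra|].
apply (peval_interior_max (diag_sum g) 0 (1 / 2)); [lra|].
intros y Hy; rewrite H0; auto.
Qed.

Lemma diag_sum_derivative_decreasing (g x y : R) :
  g_lo <= g <= g_hi -> 3 / 25 <= x -> x < y -> y <= 4 / 25 ->
  peval (pderiv (diag_sum g)) y < peval (pderiv (diag_sum g)) x.
Proof.
intros Hg Hx H Hy.
destruct (peval_MVT (pderiv (diag_sum g)) x y H) as (z & Hz & E).
assert (Hn : peval (pderiv (pderiv (diag_sum g))) z < 0)
  by (apply diag_sum_second_derivative_neg; lra).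
nra.
Qed.

(** Zeros of a nonpositive function are maxima, hence critical, and the derivative is strictly
    decreasing where they lie. *)
Lemma diag_sum_zero_unique (g u u' : R) :
  g_lo <= g <= g_hi ->
  (forall x, 0 <= x <= 1 / 2 -> peval (diag_sum g) x <= 0) ->
  0 <= u <= 1 / 2 -> peval (diag_sum g) u = 0 ->
  0 <= u' <= 1 / 2 -> peval (diag_sum g) u' = 0 -> u' = u.
Proof.
intros Hg Hmax Hu H0 Hu' H0'.
destruct (diag_sum_zero_location g u Hg Hmax Hu H0) as [L E].
destruct (diag_sum_zero_location g u' Hg Hmax Hu' H0') as [L' E'].
destruct (Rtotal_order u u') as [H|[H|H]]; [exfalso| auto | exfalso].
- assert (H' := diag_sum_derivative_decreasing g u u' Hg); lra.
- assert (H' := diag_sum_derivative_decreasing g u' u Hg); lra.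
Qed.

Lemma diag_sum_zero_enclosure (g u : R) :
  g_lo <= g <= g_hi -> 3 / 25 <= u <= 4 / 25 ->
  peval (pderiv (diag_sum g)) u = 0 -> rounds_to 6 u u_0.
Proof.
intros Hg Hu E.
destruct (diag_sum_derivative_u_0 g Hg) as (_ & H1 & H2).
unfold rounds_to; apply Rabs_le; unfold u_0 in *.
split; apply Rnot_lt_le; intro H.
- assert (H' := diag_sum_derivative_decreasing g u (139979 / 10 ^ 6 - / 2 * / 10 ^ 6) Hg); lra.
- assert (H' := diag_sum_derivative_decreasing g (139979 / 10 ^ 6 + / 2 * / 10 ^ 6) u Hg); lra.
Qed.

(** * Bounds on the whole triangle *)

(** The difference quotient in [g] between [g] and [g'] is [a * (g + g') + b]; the two bounds give
    its sign for [g + g'] at least [6 / 5] or at most [- 1 / 3]. *)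
Lemma diag_slope (u : R) :
  3 / 25 <= u <= 4 / 25 ->
  exists a b, (forall g, peval (diag 0 g) u = peval (diag 0 0) u + b * g + a * g ^ 2)
    /\ 0 < a * (6 / 5) + b /\ a * (- 1 / 3) + b < 0.
Proof.
intro Hu; assert (Hq := q5_bounds).
set (a := (peval (diag 0 1) u + peval (diag 0 (-1)) u) / 2 - peval (diag 0 0) u).
set (b := (peval (diag 0 1) u - peval (diag 0 (-1)) u) / 2).
assert (E : forall g, peval (diag 0 g) u = peval (diag 0 0) u + b * g + a * g ^ 2).
{ intro g; unfold a, b; rewrite !peval_diag.
  unfold err, e20, e30, e01, e11, e21, e02, e12; field. }
assert (H1 : peval (hadd (-1) (diag 0 (6 / 5)) (diag 0 0)) u < 0)
  by bernstein_numeric (3 / 25) (4 / 25).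
assert (H2 : peval (hadd (-1) (diag 0 (- 1 / 3)) (diag 0 0)) u < 0)
  by bernstein_numeric (3 / 25) (4 / 25).
assert (Eh : forall g, peval (hadd (-1) (diag 0 g) (diag 0 0)) u =
  peval (diag 0 0) u - peval (diag 0 g) u)
  by (intro g; unfold diag; cbn [hadd peval]; ring).
rewrite Eh, (E (6 / 5)) in H1; rewrite Eh, (E (- 1 / 3)) in H2.
exists a, b; split; [exact E|]; split; lra.
Qed.

Lemma coefficient_bounds (g : R) :
  g_lo <= g <= g_hi ->
  62220 / 10 ^ 7 < e20 g < 62225 / 10 ^ 7 /\
  - 289402 / 10 ^ 7 < e30 g < - 289398 / 10 ^ 7 /\
  - 85990 / 10 ^ 7 < e01 g < - 85986 / 10 ^ 7 /\
  694976 / 10 ^ 7 < e11 g < 694980 / 10 ^ 7 /\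
  - 663248 / 10 ^ 7 < e21 g < - 663244 / 10 ^ 7 /\
  1202796 / 10 ^ 7 < e02 g < 1202800 / 10 ^ 7 /\
  - 380007 / 10 ^ 7 < e12 g < - 380005 / 10 ^ 7 /\
  - 63304 / 10 ^ 9 < mid g < - 63301 / 10 ^ 9.
Proof.
intro Hg; center_gamma g; unfold mid; expand_coefficients.
repeat split; lra.
Qed.

(** At [x = 1 / 2], an edge midpoint, the value is [mid g] and the slope vanishes because the normal
    is radial there. Dividing twice by [x - 1 / 2] leaves a positive factor. *)
Lemma diag_above_midpoint (g x : R) :
  g_lo <= g <= g_hi -> 1 / 3 <= x <= 1 / 2 -> mid g <= peval (diag 0 g) x.
Proof.
intros Hg Hx.
rewrite (peval_pquot (1 / 2)), (peval_pquot (1 / 2) x (pquot _ _)).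
replace (peval (diag 0 g) (1 / 2)) with (mid g)
  by (rewrite peval_diag; unfold err, mid; field).
replace (peval (pquot (1 / 2) (diag 0 g)) (1 / 2)) with 0
  by (unfold diag; cbn [pquot peval]; unfold e20, e30, e01, e11, e21, e02, e12; field).
assert (H : peval (map Ropp (pquot (1 / 2) (pquot (1 / 2) (diag 0 g)))) x < 0).
{ center_gamma g; bernstein_numeric (1 / 3) (1 / 2). }
assert (E : peval (map Ropp (pquot (1 / 2) (pquot (1 / 2) (diag 0 g)))) x =
  - peval (pquot (1 / 2) (pquot (1 / 2) (diag 0 g))) x)
  by (unfold diag; cbn [pquot map peval]; ring).
rewrite E in H.
assert (Hx2 := pow2_ge_0 (x - 1 / 2)); nra.
Qed.

(** [r] and [1 - 2 * r] are the roots, [r] double, of the cubic with the same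
    first two elementary symmetric functions as [u], [v], [w]. *)
Lemma product_comparison (u v w r : R) :
  u + v + w = 1 ->
  u * v + v * w + w * u = r * (2 - 3 * r) ->
  u * v * w - r ^ 2 * (1 - 2 * r) = (w - r) ^ 2 * (w - (1 - 2 * r)).
Proof.
intros H1 H2.
assert (H : u * v = r * (2 - 3 * r) - w * (1 - w))
  by (replace (1 - w) with (u + v) by lra; lra).
rewrite H; ring.
Qed.

(** By convexity in [t] the error lies below its chord from [t = 0] to the diagonal value [T], so
    only the two ends need bounding. *)
Lemma err_upper (g s t : R) :
  g_lo <= g <= g_hi -> 0 <= s <= 1 / 3 ->
  (forall x, 0 <= x <= 1 / 2 -> peval (diag_sum g) x <= 0) ->
  (exists r, 0 <= r <= 1 / 3 /\ s = r * (2 - 3 * r) /\ 0 <= t <= r ^ 2 * (1 - 2 * r)) ->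
  err g s t <= - mid g.
Proof.
intros Hg Hs Hmax (r & Hr & Es & Ht).
destruct (coefficient_bounds g Hg) as (H20 & H30 & H01 & H11 & H21 & H02 & H12 & Hm).
assert (Hr' : peval (diag_sum g) r <= 0) by (apply Hmax; lra).
rewrite peval_diag_sum, peval_diag, <- Es, Rplus_0_l in Hr'.
set (T := r ^ 2 * (1 - 2 * r)) in *.
assert (H0 : err g s 0 <= - mid g).
{ unfold err.
  (* The maximum of the cubic [err g s 0] over positive [s], minus the cubic, has a double root near
     143/1000 and a simple one near -7/100. *)
  assert (0 <= (s + 7 / 100) * (s - 143 / 1000) ^ 2)
    by (apply Rmult_le_pos; [lra|apply pow2_ge_0]).
  assert (Hs2 := pow2_ge_0 s).
  assert (0 <= s ^ 3) by (apply pow_le; lra).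
  nra. }
destruct (Rle_lt_or_eq_dec 0 T) as [HT|HT]; [lra| |].
- assert (Hc : err g s t <= (1 - t / T) * err g s 0 + t / T * err g s T).
  { replace (err g s t) with
      ((1 - t / T) * err g s 0 + t / T * err g s T
        - (e02 g + e12 g * s) * (t * (T - t))) by (unfold err; field; lra).
    assert (0 <= (e02 g + e12 g * s) * (t * (T - t))); [|lra].
    apply Rmult_le_pos; [nra|apply Rmult_le_pos; lra]. }
  assert (0 <= t / T) by (apply Rdiv_le_0_compat; lra).
  assert (t / T <= 1) by (apply Rle_div_l; lra).
  nra.
- replace t with 0 by lra; exact H0.
Qed.

(** For small [s] the coefficient of [t] may be negative, but [t <= s ^ 2 / 3] keeps the error
    nonnegative. From [3 / 20] on the error increases with [t]: up to [1 / 4] the edge [t = 0] is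
    the comparison, beyond it the diagonal. *)
Lemma err_lower (g s t : R) :
  g_lo <= g <= g_hi -> 0 <= s <= 1 / 3 -> 0 <= t <= s ^ 2 / 3 ->
  (1 / 4 <= s -> exists x, 1 / 3 <= x <= 1 / 2 /\ s = x * (2 - 3 * x) /\
     x ^ 2 * (1 - 2 * x) <= t) ->
  mid g <= err g s t.
Proof.
intros Hg Hs Ht Hx.
destruct (coefficient_bounds g Hg) as (H20 & H30 & H01 & H11 & H21 & H02 & H12 & Hm).
assert (Hc : 0 < e02 g + e12 g * s) by nra.
assert (Hs2 := pow2_ge_0 s); assert (Ht2 := pow2_ge_0 t).
destruct (Rle_lt_dec s (3 / 20)) as [H1|H1]; [|destruct (Rle_lt_dec s (1 / 4)) as [H2|H2]].
(* For [s <= 3 / 20] the slope [e11 g + e21 g * s] stays above 59/1000. *)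
- assert (HK : - 85990 / 10 ^ 7 + 59 / 1000 * s <= e01 g + e11 g * s + e21 g * s ^ 2) by nra.
  assert (HA : 62220 / 10 ^ 7 - 289402 / 10 ^ 7 * s <= e20 g + e30 g * s) by nra.
  unfold err.
  set (K := e01 g + e11 g * s + e21 g * s ^ 2) in *.
  assert (HKt : - s ^ 2 * (62220 / 10 ^ 7 - 289402 / 10 ^ 7 * s) <= K * t).
  { destruct (Rle_lt_dec 0 K) as [H|H].
    - assert (0 <= K * t) by (apply Rmult_le_pos; lra).
      assert (0 <= s ^ 2 * (62220 / 10 ^ 7 - 289402 / 10 ^ 7 * s))
        by (apply Rmult_le_pos; lra); lra.
    - assert (K * (s ^ 2 / 3) <= K * t) by nra.
      assert (0 <= s ^ 2 * (62220 / 10 ^ 7 - 289402 / 10 ^ 7 * s + K / 3))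
        by (apply Rmult_le_pos; lra); lra. }
  assert (0 <= s ^ 2 * ((e20 g + e30 g * s) - (62220 / 10 ^ 7 - 289402 / 10 ^ 7 * s)))
    by (apply Rmult_le_pos; lra).
  assert (0 <= (e02 g + e12 g * s) * t ^ 2) by (apply Rmult_le_pos; lra).
  lra.
- assert (HK : 0 <= e01 g + e11 g * s + e21 g * s ^ 2) by nra.
  assert (Hd : mid g <= e20 g * s ^ 2 + e30 g * s ^ 3).
  { replace (e20 g * s ^ 2 + e30 g * s ^ 3) with
      (mid g + (s - 1 / 4) * (e20 g * (s + 1 / 4) + e30 g * (s ^ 2 + s / 4 + 1 / 16)))
      by (unfold mid; field).
    assert (e20 g * (s + 1 / 4) + e30 g * (s ^ 2 + s / 4 + 1 / 16) <= 0) by nra.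
    nra. }
  unfold err; nra.
- destruct Hx as (x & Hx & Es & Hxt); [lra|].
  assert (H := diag_above_midpoint g x Hg Hx).
  rewrite peval_diag, <- Es, Rplus_0_l in H.
  set (T := x ^ 2 * (1 - 2 * x)) in *.
  assert (0 <= T) by (apply Rmult_le_pos; [apply pow2_ge_0|lra]).
  assert (HK : 0 <= e01 g + e11 g * s + e21 g * s ^ 2) by nra.
  apply (Rle_trans _ _ _ H); unfold err.
  assert (T ^ 2 <= t ^ 2) by (apply pow_incr; lra).
  nra.
Qed.

(** * Normals *)

(** The coefficients [b.b] and [-a.b] combine [a] and [b] into the triple product of [b] with
    [cross a b]. If that cross product vanished, independence would force [b = 0]. *)
Lemma lin_indep_cross (a b : vec) :
  lin_indep a b -> cross a b <> (zero : vec).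
Proof.
destruct a as [[a1 a2] a3], b as [[b1 b2] b3].
intros H E; rewrite vec_zero in E; injection E as E1 E2 E3.
destruct (H (b1 * b1 + b2 * b2 + b3 * b3) (- (a1 * b1 + a2 * b2 + a3 * b3)))
  as [Hb _].
- rewrite !vec_scal, vec_plus, vec_zero.
  apply f_equal2; [apply f_equal2|].
  + transitivity ((a1 * b2 - a2 * b1) * b2 - (a3 * b1 - a1 * b3) * b3);
      [ring|rewrite E2, E3; ring].
  + transitivity ((a2 * b3 - a3 * b2) * b3 - (a1 * b2 - a2 * b1) * b1);
      [ring|rewrite E1, E3; ring].
  + transitivity ((a3 * b1 - a1 * b3) * b1 - (a2 * b3 - a3 * b2) * b2);
      [ring|rewrite E1, E2; ring].
- assert (b1 = 0 /\ b2 = 0 /\ b3 = 0) as (-> & -> & ->) by (repeat split; nra).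
  destruct (H 0 1) as [_ H1]; [|lra].
  rewrite !vec_scal, vec_plus, vec_zero.
  apply f_equal2; [apply f_equal2|]; ring.
Qed.

(** The triple product of [n] with [cross a b] vanishes, so [cross a b] equals its projection on the
    unit vector [n]. *)
Lemma parallel_cross (a b n : vec) :
  dot n n = 1 -> dot a n = 0 -> dot b n = 0 -> parallel (cross a b) n.
Proof.
intros Hn Ha Hb; exists (dot (cross a b) n).
destruct a as [[a1 a2] a3], b as [[b1 b2] b3], n as [[n1 n2] n3].
rewrite vec_scal; simpl in *.
apply f_equal2; [apply f_equal2|];
  (rewrite <- Rmult_1_r at 1; rewrite <- Hn).
- transitivity (((a2 * b3 - a3 * b2) * n1 + (a3 * b1 - a1 * b3) * n2
      + (a1 * b2 - a2 * b1) * n3) * n1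
    + n2 * (b3 * (a1 * n1 + a2 * n2 + a3 * n3) - a3 * (b1 * n1 + b2 * n2 + b3 * n3))
    - n3 * (b2 * (a1 * n1 + a2 * n2 + a3 * n3) - a2 * (b1 * n1 + b2 * n2 + b3 * n3)));
    [ring|rewrite Ha, Hb; ring].
- transitivity (((a2 * b3 - a3 * b2) * n1 + (a3 * b1 - a1 * b3) * n2
      + (a1 * b2 - a2 * b1) * n3) * n2
    + n3 * (b1 * (a1 * n1 + a2 * n2 + a3 * n3) - a1 * (b1 * n1 + b2 * n2 + b3 * n3))
    - n1 * (b3 * (a1 * n1 + a2 * n2 + a3 * n3) - a3 * (b1 * n1 + b2 * n2 + b3 * n3)));
    [ring|rewrite Ha, Hb; ring].
- transitivity (((a2 * b3 - a3 * b2) * n1 + (a3 * b1 - a1 * b3) * n2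
      + (a1 * b2 - a2 * b1) * n3) * n3
    + n1 * (b2 * (a1 * n1 + a2 * n2 + a3 * n3) - a2 * (b1 * n1 + b2 * n2 + b3 * n3))
    - n2 * (b1 * (a1 * n1 + a2 * n2 + a3 * n3) - a1 * (b1 * n1 + b2 * n2 + b3 * n3)));
    [ring|rewrite Ha, Hb; ring].
Qed.

Lemma parallel_cross_inv (a b n : vec) :
  lin_indep a b -> parallel (cross a b) n -> dot a n = 0.
Proof.
intros Hi [k E].
assert (Hk : k <> 0).
{ intros ->; apply (lin_indep_cross a b Hi); rewrite E.
  destruct n as [[n1 n2] n3]; rewrite vec_scal, vec_zero.
  apply f_equal2; [apply f_equal2|]; ring. }
apply (Rmult_eq_reg_l k); [|exact Hk].
destruct a as [[a1 a2] a3], b as [[b1 b2] b3], n as [[n1 n2] n3].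
rewrite vec_scal in E; injection E as E1 E2 E3; simpl.
transitivity (a1 * (k * n1) + a2 * (k * n2) + a3 * (k * n3)); [ring|].
rewrite <- E1, <- E2, <- E3; ring.
Qed.

Lemma dot_cross_cross (a b p d : vec) :
  dot (cross a b) (cross p d) = dot a p * dot b d - dot a d * dot b p.
Proof.
destruct a as [[a1 a2] a3], b as [[b1 b2] b3], p as [[p1 p2] p3],
  d as [[d1 d2] d3]; simpl; ring.
Qed.

Lemma in_plane_normal (n p d : vec) :
  dot (cross p d) (cross p d) <> 0 ->
  in_plane n p d <-> dot n (cross p d) = 0.
Proof.
intro HD; split.
- intros (s & t & ->).
  destruct p as [[p1 p2] p3], d as [[d1 d2] d3].
  rewrite !vec_scal, vec_plus; simpl; ring.
- intro H; set (m := cross p d) in *.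
  (* Cramer's rule in the basis [p], [d], [m]; the component along [m] is zero. *)
  exists (dot (cross n d) m / dot m m), (dot (cross p n) m / dot m m).
  destruct n as [[n1 n2] n3], p as [[p1 p2] p3], d as [[d1 d2] d3].
  rewrite !vec_scal, vec_plus.
  assert (K : forall x a b y z r, x * r = y * a + z * b + 0 -> r <> 0 ->
     x = y / r * a + z / r * b).
  { intros x a b y z r E Hr; apply (Rmult_eq_reg_r r); [|exact Hr].
    rewrite E; field; exact Hr. }
  apply f_equal2; [apply f_equal2|]; (apply K; [|exact HD]).
  + transitivity (dot (cross (n1, n2, n3) (d1, d2, d3)) m * p1
      + dot (cross (p1, p2, p3) (n1, n2, n3)) m * d1
      + dot (n1, n2, n3) m * (p2 * d3 - p3 * d2)); [|rewrite H; ring].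
    unfold m; simpl; ring.
  + transitivity (dot (cross (n1, n2, n3) (d1, d2, d3)) m * p2
      + dot (cross (p1, p2, p3) (n1, n2, n3)) m * d2
      + dot (n1, n2, n3) m * (p3 * d1 - p1 * d3)); [|rewrite H; ring].
    unfold m; simpl; ring.
  + transitivity (dot (cross (n1, n2, n3) (d1, d2, d3)) m * p3
      + dot (cross (p1, p2, p3) (n1, n2, n3)) m * d3
      + dot (n1, n2, n3) m * (p1 * d2 - p2 * d1)); [|rewrite H; ring].
    unfold m; simpl; ring.
Qed.

Lemma v0_comb : v0 c_ico = comb c_ico 1 0 0.
Proof.
rewrite comb_coords; unfold v0; apply f_equal2; [apply f_equal2|]; field.
Qed.

Lemma v1_comb : v1 c_ico = comb c_ico 0 1 0.
Proof.
rewrite comb_coords; unfold v1; apply f_equal2; [apply f_equal2|]; field.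
Qed.

Lemma v2_comb : v2 c_ico = comb c_ico 0 0 1.
Proof.
rewrite comb_coords; unfold v2; apply f_equal2; [apply f_equal2|]; field.
Qed.

Lemma in_plane_cross (a b p d : vec) :
  dot p p = 1 -> dot d d = 1 -> dot p d = q5 / 5 -> dot d p = q5 / 5 ->
  in_plane (cross a b) p d <-> dot a p * dot b d - dot a d * dot b p = 0.
Proof.
intros Hp Hd Hpd Hdp.
rewrite in_plane_normal, dot_cross_cross; [reflexivity|].
rewrite dot_cross_cross, Hp, Hd, Hpd, Hdp.
replace (_ - _) with (1 - q5 ^ 2 / 25) by field.
rewrite q5_sqr; lra.
Qed.

(** The hypothesis is a determinant with third row (1, 1, 1), proportional to the third component of
    the cross product. *)
Lemma comb_lin_indep (x y z x' y' z' : R) :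
  (x * y' - y * x') + (y * z' - z * y') + (z * x' - x * z') <> 0 ->
  lin_indep (comb c_ico x y z) (comb c_ico x' y' z').
Proof.
intros HJ s t E.
rewrite !comb_coords, !vec_scal, vec_plus, vec_zero in E.
assert (Hc := c_ico_pos); assert (H3 := sqrt3_sqr); assert (Hh := height_sqr).
assert (Hq := q5_bounds).
set (h := sqrt (1 - c_ico ^ 2)) in *; clearbody h.
injection E as E1 E2 E3.
assert (X1 : s * (x - (y + z) / 2) + t * (x' - (y' + z') / 2) = 0).
{ apply (Rmult_eq_reg_l c_ico); [|lra]; rewrite Rmult_0_r, <- E1; ring. }
assert (X2 : s * (y - z) + t * (y' - z') = 0).
{ apply (Rmult_eq_reg_l (c_ico * sqrt 3 / 2)).
  - rewrite Rmult_0_r, <- E2; field.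
  - assert (0 < sqrt 3) by (apply sqrt_lt_R0; lra); nra. }
assert (X3 : s * (x + y + z) + t * (x' + y' + z') = 0).
{ apply (Rmult_eq_reg_l h).
  - rewrite Rmult_0_r, <- E3; ring.
  - intros ->; lra. }
assert (Ex : s * x + t * x' = 0) by lra.
assert (Ey : s * y + t * y' = 0) by lra.
assert (Ez : s * z + t * z' = 0) by lra.
split; refine (Rmult_eq_reg_r _ _ 0 _ HJ); rewrite Rmult_0_l.
- transitivity ((s * x + t * x') * (y' - z') + (s * y + t * y') * (z' - x')
    + (s * z + t * z') * (x' - y')); [ring|rewrite Ex, Ey, Ez; ring].
- transitivity (- ((s * x + t * x') * (y - z) + (s * y + t * y') * (z - x)
    + (s * z + t * z') * (x - y))); [ring|rewrite Ex, Ey, Ez; ring].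
Qed.

(** * The family satisfies the conditions *)

(** Jacobian of the projection of [p_ico g] to the horizontal plane, up to a
    constant factor; as a symmetric function of the barycentric coordinates it
    depends only on [s] and [t]. *)
Definition jacobian (g s t : R) : R :=
  9 / 8 * (25 + 11 * q5) * (2 * g - 1) ^ 2
  + (- (945 + 441 * q5) / 4 + (846 + 396 * q5) * g - (747 + 351 * q5) * g ^ 2) * s
  + (90 + 171 * q5 - (432 + 468 * q5) * g + (432 + 324 * q5) * g ^ 2) * s ^ 2
  + ((3249 + 621 * q5) / 4 - (2052 + 666 * q5) * g + (1431 + 567 * q5) * g ^ 2) * t
  + ((3231 + 531 * q5) / 2 - (4266 + 1242 * q5) * g + (3078 + 1134 * q5) * g ^ 2)
    * s * t
  + (4428 - 1296 * q5 - (7776 - 1296 * q5) * g + 3888 * g ^ 2) * t ^ 2.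

(** For these [g] every coefficient is nonnegative and the constant one is positive. *)
Lemma jacobian_pos (g s t : R) :
  g_lo <= g <= g_hi -> 0 <= s -> 0 <= t -> 0 < jacobian g s t.
Proof.
intros Hg Hs Ht; unfold jacobian.
assert (H0 : 0 < 9 / 8 * (25 + 11 * q5) * (2 * g - 1) ^ 2).
{ assert (Hq := q5_bounds).
  repeat apply Rmult_lt_0_compat; try lra;
  unfold g_lo, g_hi in *; lra. }
assert (Hs2 : 0 <= s ^ 2) by (apply pow2_ge_0).
assert (Ht2 : 0 <= t ^ 2) by (apply pow2_ge_0).
assert (Hst : 0 <= s * t) by (apply Rmult_le_pos; auto).
rewrite (Rmult_assoc _ s t).
repeat apply Rplus_lt_le_0_compat; [exact H0|..];
  (apply Rmult_le_pos; [|assumption]); clear H0; center_gamma g; lra.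
Qed.

Lemma p_ico_lin_indep (g u v : R) :
  g_lo <= g <= g_hi -> Defs.Delta u v ->
  lin_indep (patch_du (p_ico g) u v) (patch_dv (p_ico g) u v).
Proof.
intros Hg (Hu & Hv & Hw).
unfold p_ico; destruct (ico_parameters g) as (-> & -> & -> & ->).
rewrite patch_du_comb, patch_dv_comb; apply comb_lin_indep.
apply Rgt_not_eq, Rlt_gt.
assert (Hs : 0 <= u * v) by (apply Rmult_le_pos; lra).
assert (Hs' : 0 <= (u + v) * (1 - u - v)) by (apply Rmult_le_pos; lra).
assert (Ht : 0 <= u * v * (1 - u - v)) by (apply Rmult_le_pos; lra).
replace (_ + _) with
  (jacobian g (u * v + (u + v) * (1 - u - v)) (u * v * (1 - u - v)));
  [apply jacobian_pos; lra|].
assert (Hq := q5_sqr).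
unfold jacobian, weight_x, weight_y, al_ico, be_ico, ze_ico, xi_ico.
field_simplify_eq; ring [Hq].
Qed.

Lemma vertex_dots :
  dot (v0 c_ico) (v0 c_ico) = 1 /\ dot (v1 c_ico) (v1 c_ico) = 1 /\
  dot (v2 c_ico) (v2 c_ico) = 1 /\
  dot (v0 c_ico) (v1 c_ico) = q5 / 5 /\ dot (v1 c_ico) (v0 c_ico) = q5 / 5 /\
  dot (v0 c_ico) (v2 c_ico) = q5 / 5 /\ dot (v2 c_ico) (v0 c_ico) = q5 / 5 /\
  dot (v1 c_ico) (v2 c_ico) = q5 / 5 /\ dot (v2 c_ico) (v1 c_ico) = q5 / 5.
Proof.
rewrite v0_comb, v1_comb, v2_comb, !dot_comb; repeat split; field.
Qed.

(** The vertex and edge conditions are polynomial identities in [g]; the enclosure enters through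
    regularity. *)
Lemma p_ico_G1_admissible (g : R) :
  g_lo <= g <= g_hi -> G1_admissible c_ico (p_ico g).
Proof.
intro Hg; assert (Hq := q5_sqr).
destruct vertex_dots as (D0 & D1 & D2 & D01 & D10 & D02 & D20 & D12 & D21).
split; [intros; apply p_ico_lin_indep; auto|].
unfold patch_normal, p_ico; destruct (ico_parameters g) as (-> & -> & -> & ->).
split; [split; [|split]|].
- apply parallel_cross; [exact D0| |];
    rewrite ?patch_du_comb, ?patch_dv_comb, v0_comb, dot_comb;
    unfold weight_x, weight_y, al_ico, be_ico, ze_ico, xi_ico;
    field_simplify_eq; ring [Hq].
- apply parallel_cross; [exact D1| |];
    rewrite ?patch_du_comb, ?patch_dv_comb, v1_comb, dot_comb;
    unfold weight_x, weight_y, al_ico, be_ico, ze_ico, xi_ico;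
    field_simplify_eq; ring [Hq].
- apply parallel_cross; [exact D2| |];
    rewrite ?patch_du_comb, ?patch_dv_comb, v2_comb, dot_comb;
    unfold weight_x, weight_y, al_ico, be_ico, ze_ico, xi_ico;
    field_simplify_eq; ring [Hq].
- intros u v _; split; [|split]; intro E.
  + replace v with (1 - u) by lra.
    apply in_plane_cross; auto.
    rewrite patch_du_comb, patch_dv_comb, v0_comb, v1_comb, !dot_comb.
    unfold weight_x, weight_y, al_ico, be_ico, ze_ico, xi_ico.
    field_simplify_eq; ring [Hq].
  + rewrite E; apply in_plane_cross; auto.
    rewrite patch_du_comb, patch_dv_comb, v1_comb, v2_comb, !dot_comb.
    unfold weight_x, weight_y, al_ico, be_ico, ze_ico, xi_ico.
    field_simplify_eq; ring [Hq].
  + rewrite E; apply in_plane_cross; auto.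
    rewrite patch_du_comb, patch_dv_comb, v0_comb, v2_comb, !dot_comb.
    unfold weight_x, weight_y, al_ico, be_ico, ze_ico, xi_ico.
    field_simplify_eq; ring [Hq].
Qed.

(** * Necessary conditions along an edge *)

(** The nonzero coefficients of the edge condition, a palindromic form of degree 6
    in [u] and [1 - u] (see [edge_normal_polynomial]). *)
Definition edge1 (b g z x : R) : R :=
  - 3 - 3 / 5 * (1 + q5) * g + 6 / 5 * (1 + q5) * x + (3 + 3 / 5 * q5) * z.
Definition edge2 (b g z x : R) : R :=
  (3 * q5 + 39 / 5) * b * g - 12 / 5 * q5 * b * x
  - (6 / 5 * q5 + 42 / 5) * b * z - 3 / 5 * b - 12 / 25 * q5 * b ^ 2
  + (9 / 5 * q5 + 9) * (g * z - g * x - g) + (18 / 5 * q5 + 9) * x.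
Definition edge3 (b g z x : R) : R :=
  (18 / 5 * q5 + 18 / 5) * b * (1 - z) - (36 / 5 * q5 + 108 / 5) * b * x
  + (8 / 5 * q5 + 32 / 5) * b ^ 2 + (18 / 5 * q5 + 18) * (g * x - g * z + z)
  - (9 / 5 * q5 + 9) + 18 / 5 * q5 * x.

Lemma edge_normal_polynomial (b g z x u : R) (w := 1 - u)
    (p := quartic_patch c_ico (1 - q5 / 5 * b) b g z x) :
  dot (patch_du p u 0) (v0 c_ico) * dot (patch_dv p u 0) (v2 c_ico)
  - dot (patch_du p u 0) (v2 c_ico) * dot (patch_dv p u 0) (v0 c_ico) =
  16 * (1 - q5 / 5) * (u * w) *
  (b * edge1 b g z x * (u ^ 4 + w ^ 4) + edge2 b g z x * (u * w) * (u ^ 2 + w ^ 2)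
   + edge3 b g z x * (u * w) ^ 2).
Proof.
unfold p; rewrite patch_du_comb, patch_dv_comb, v0_comb, v2_comb, !dot_comb.
assert (Hq := q5_sqr).
unfold weight_x, weight_y, edge1, edge2, edge3, w.
field_simplify_eq; ring [Hq].
Qed.

(** The determinant of [edge1], [edge2], [edge3] as a linear system in [z], [x],
    expanded along the constant column. *)
Lemma edge_determinant (b g z x : R) :
  edge1 b g z x = 0 -> edge2 b g z x = 0 -> edge3 b g z x = 0 ->
  (b - be_ico g) *
  ((b - (15 - 3 * q5) / 8) * (g + (5 - q5) / 15 * b - (5 - q5) / 4)) = 0.
Proof.
intros E1 E2 E3; assert (Hq := q5_sqr); assert (Hq' := q5_bounds).
apply (Rmult_eq_reg_l ((24192 + 10368 * q5) / 125)); [|lra].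
rewrite Rmult_0_r.
transitivity (
  ((3 + 3 / 5 * q5) * (- 12 / 5 * q5 * b - (9 / 5 * q5 + 9) * g + 18 / 5 * q5 + 9)
   - (- (6 / 5 * q5 + 42 / 5) * b + (9 / 5 * q5 + 9) * g) * (6 / 5 * (1 + q5)))
    * edge3 b g z x
  - ((3 + 3 / 5 * q5) * (- (36 / 5 * q5 + 108 / 5) * b + (18 / 5 * q5 + 18) * g + 18 / 5 * q5)
     - (- (18 / 5 * q5 + 18 / 5) * b + (18 / 5 * q5 + 18) * (1 - g)) * (6 / 5 * (1 + q5)))
    * edge2 b g z x
  + ((- (6 / 5 * q5 + 42 / 5) * b + (9 / 5 * q5 + 9) * g)
      * (- (36 / 5 * q5 + 108 / 5) * b + (18 / 5 * q5 + 18) * g + 18 / 5 * q5)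
     - (- (18 / 5 * q5 + 18 / 5) * b + (18 / 5 * q5 + 18) * (1 - g))
      * (- 12 / 5 * q5 * b - (9 / 5 * q5 + 9) * g + 18 / 5 * q5 + 9))
    * edge1 b g z x); [|rewrite E1, E2, E3; ring].
unfold edge1, edge2, edge3, be_ico; field_simplify_eq; ring [Hq].
Qed.

(** The stated pair solves the first two equations, and their determinant in [z], [x] is a nonzero
    multiple of [b - (15 - 3 * q5) / 8]. *)
Lemma edge_solution (g z x : R) (b := be_ico g) :
  edge1 b g z x = 0 -> edge2 b g z x = 0 -> b <> (15 - 3 * q5) / 8 ->
  z = ze_ico g /\ x = xi_ico g.
Proof.
intros E1 E2 Hb; assert (Hq := q5_sqr); assert (Hq' := q5_bounds).
set (z1 := 3 + 3 / 5 * q5). set (x1 := 6 / 5 * (1 + q5)).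
set (z2 := - (6 / 5 * q5 + 42 / 5) * b + (9 / 5 * q5 + 9) * g).
set (x2 := - 12 / 5 * q5 * b - (9 / 5 * q5 + 9) * g + 18 / 5 * q5 + 9).
assert (F1 : z1 * (z - ze_ico g) + x1 * (x - xi_ico g) = 0).
{ rewrite <- E1; unfold z1, x1, edge1, ze_ico, xi_ico.
  field_simplify_eq; ring [Hq]. }
assert (F2 : z2 * (z - ze_ico g) + x2 * (x - xi_ico g) = 0).
{ rewrite <- E2; unfold z2, x2, edge2, b, ze_ico, xi_ico, be_ico.
  field_simplify_eq; ring [Hq]. }
assert (Hm : z1 * x2 - z2 * x1 <> 0).
{ replace (z1 * x2 - z2 * x1)
    with (- (252 + 108 * q5) / 25 * (b - (15 - 3 * q5) / 8)).
  - apply Rmult_integral_contrapositive; split; lra.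
  - unfold z1, x1, z2, x2, b, be_ico; field_simplify_eq; ring [Hq]. }
split.
- apply Rminus_diag_uniq, (Rmult_eq_reg_l _ _ _) with (2 := Hm).
  rewrite Rmult_0_r.
  transitivity (x2 * (z1 * (z - ze_ico g) + x1 * (x - xi_ico g))
    - x1 * (z2 * (z - ze_ico g) + x2 * (x - xi_ico g)));
    [ring|rewrite F1, F2; ring].
- apply Rminus_diag_uniq, (Rmult_eq_reg_l _ _ _) with (2 := Hm).
  rewrite Rmult_0_r.
  transitivity (z1 * (z2 * (z - ze_ico g) + x2 * (x - xi_ico g))
    - z2 * (z1 * (z - ze_ico g) + x1 * (x - xi_ico g)));
    [ring|rewrite F1, F2; ring].
Qed.

(** At (0,0) the [u]-derivative is orthogonal to [v2], a linear relation between [al] and [b]. With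
    [b = 0] this derivative would vanish, against regularity. *)
Lemma G1_vertex_condition (al b g z x : R) :
  G1_admissible c_ico (quartic_patch c_ico al b g z x) ->
  al = 1 - q5 / 5 * b /\ b <> 0.
Proof.
intros (Hreg & (_ & _ & H2) & _).
assert (Hi := Hreg 0 0 ltac:(unfold Defs.Delta; lra)).
assert (H := parallel_cross_inv _ _ _ Hi H2).
rewrite patch_du_comb, v2_comb, dot_comb in H.
assert (Hal : al = 1 - q5 / 5 * b) by (unfold weight_x, weight_y in H; lra).
split; [exact Hal|].
intros Hb; subst.
destruct (Hi 1 0) as [H1 _]; [|lra].
rewrite patch_du_comb, patch_dv_comb, !comb_coords, !vec_scal, vec_plus, vec_zero.
unfold weight_x, weight_y; apply f_equal2; [apply f_equal2|]; field.
Qed.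

Lemma G1_edge_conditions (b g z x : R) :
  G1_admissible c_ico (quartic_patch c_ico (1 - q5 / 5 * b) b g z x) ->
  b <> 0 ->
  edge1 b g z x = 0 /\ edge2 b g z x = 0 /\ edge3 b g z x = 0.
Proof.
intros (_ & _ & Hedge) Hb; assert (Hq := q5_bounds).
assert (E : forall u, 0 < u < 1 ->
  b * edge1 b g z x * (u ^ 4 + (1 - u) ^ 4)
  + edge2 b g z x * (u * (1 - u)) * (u ^ 2 + (1 - u) ^ 2)
  + edge3 b g z x * (u * (1 - u)) ^ 2 = 0).
{ intros u Hu.
  destruct (Hedge u 0 ltac:(unfold Defs.Delta; lra)) as (_ & _ & H).
  specialize (H eq_refl).
  assert (D : dot (v0 c_ico) (v0 c_ico) = 1 /\ dot (v2 c_ico) (v2 c_ico) = 1 /\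
    dot (v0 c_ico) (v2 c_ico) = q5 / 5 /\ dot (v2 c_ico) (v0 c_ico) = q5 / 5)
    by (rewrite v0_comb, v2_comb, !dot_comb; repeat split; field).
  apply in_plane_cross in H; try apply D.
  rewrite edge_normal_polynomial in H.
  apply Rmult_integral in H; destruct H as [H|H]; [exfalso|exact H].
  assert (0 < u * (1 - u)) by (apply Rmult_lt_0_compat; lra); nra. }
(* Three samples determine the three coefficients of the palindromic form. *)
assert (H2 := E (1 / 2) ltac:(lra)).
assert (H3 := E (1 / 3) ltac:(lra)).
assert (H4 := E (1 / 4) ltac:(lra)).
assert (E1 : b * edge1 b g z x = 0) by lra.
split; [apply Rmult_integral in E1; tauto|split; lra].
Qed.

(** * The radial error functional *)

(** Boundedness makes the supremum finite; [real] would send an infinite one to 0. *)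
Definition bounded_on_Delta (f : R -> R -> R) : Prop :=
  exists M, forall u v, Defs.Delta u v -> Rabs (f u v) <= M.

Lemma bounded_const (k : R) : bounded_on_Delta (fun _ _ => k).
Proof. exists (Rabs k); intros; lra. Qed.

Lemma bounded_fst : bounded_on_Delta (fun u _ => u).
Proof. exists 1; intros u v (Hu & _); apply Rabs_le; lra. Qed.

Lemma bounded_snd : bounded_on_Delta (fun _ v => v).
Proof. exists 1; intros u v (_ & Hv & _); apply Rabs_le; lra. Qed.

Lemma bounded_plus (f g : R -> R -> R) :
  bounded_on_Delta f -> bounded_on_Delta g ->
  bounded_on_Delta (fun u v => f u v + g u v).
Proof.
intros [M HM] [N HN]; exists (M + N); intros u v H.
apply (Rle_trans _ _ _ (Rabs_triang _ _)); apply Rplus_le_compat; auto.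
Qed.

Lemma bounded_opp (f : R -> R -> R) :
  bounded_on_Delta f -> bounded_on_Delta (fun u v => - f u v).
Proof. intros [M HM]; exists M; intros u v H; rewrite Rabs_Ropp; auto. Qed.

Lemma bounded_mult (f g : R -> R -> R) :
  bounded_on_Delta f -> bounded_on_Delta g ->
  bounded_on_Delta (fun u v => f u v * g u v).
Proof.
intros [M HM] [N HN]; exists (M * N); intros u v H.
rewrite Rabs_mult; apply Rmult_le_compat; auto using Rabs_pos.
Qed.

Lemma bounded_patch_error (al b g z x : R) :
  bounded_on_Delta (fun u v =>
    enorm (quartic_patch c_ico al b g z x u v) ^ 2 - 1).
Proof.
assert (H : bounded_on_Delta (fun u v =>
  gram (weight al b g z x u v (1 - u - v)) (weight al b g z x v u (1 - u - v))
       (weight al b g z x (1 - u - v) u v) - 1)).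
- unfold gram, weight, Rminus, pow.
  repeat first [apply bounded_const | apply bounded_fst | apply bounded_snd
    | apply bounded_plus | apply bounded_opp | apply bounded_mult].
- destruct H as [M HM]; exists M; intros u v H.
  rewrite quartic_patch_comb, enorm_comb; auto.
Qed.

Definition errors (p : R -> R -> vec) (e : R) : Prop :=
  exists u v, Defs.Delta u v /\ e = Rabs (enorm (p u v) ^ 2 - 1).

Lemma radial_error_lub (p : R -> R -> vec) (M : R) :
  (forall u v, Defs.Delta u v -> Rabs (enorm (p u v) ^ 2 - 1) <= M) ->
  Lub_Rbar (errors p) = Finite (radial_error p).
Proof.
intro HM.
destruct (Lub_Rbar_correct (errors p)) as [Hub Hlub].
change (radial_error p) with (real (Lub_Rbar (errors p))).
assert (H1 : Rbar_le (Lub_Rbar (errors p)) (Finite M))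
  by (apply Hlub; intros e (u & v & H & ->); exact (HM u v H)).
assert (H0 : Rbar_le (Finite (Rabs (enorm (p 0 0) ^ 2 - 1))) (Lub_Rbar (errors p))).
{ apply Hub; exists 0, 0; split; [unfold Defs.Delta; lra|reflexivity]. }
destruct (Lub_Rbar (errors p)); simpl in *; [reflexivity|contradiction|contradiction].
Qed.

Lemma radial_error_ge (p : R -> R -> vec) (u v : R) :
  bounded_on_Delta (fun u v => enorm (p u v) ^ 2 - 1) ->
  Defs.Delta u v -> Rabs (enorm (p u v) ^ 2 - 1) <= radial_error p.
Proof.
intros [M HM] H; assert (E := radial_error_lub p M HM).
destruct (Lub_Rbar_correct (errors p)) as [Hub _]; rewrite E in Hub.
apply (Hub (Rabs (enorm (p u v) ^ 2 - 1))); exists u, v; auto.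
Qed.

Lemma radial_error_le (p : R -> R -> vec) (M : R) :
  (forall u v, Defs.Delta u v -> Rabs (enorm (p u v) ^ 2 - 1) <= M) ->
  radial_error p <= M.
Proof.
intros HM; assert (E := radial_error_lub p M HM).
destruct (Lub_Rbar_correct (errors p)) as [_ Hlub]; rewrite E in Hlub.
apply (Hlub (Finite M)); intros e (u & v & H & ->); exact (HM u v H).
Qed.

Lemma edge_error (b g z x u : R)
    (P := fun u w => weight (1 - q5 / 5 * b) b g z x u 0 w) :
  enorm (quartic_patch c_ico (1 - q5 / 5 * b) b g z x u 0) ^ 2 =
  P u (1 - u) ^ 2 + P (1 - u) u ^ 2 + 2 * q5 / 5 * (P u (1 - u) * P (1 - u) u).
Proof.
rewrite quartic_patch_comb, enorm_comb; unfold gram, P, weight; field.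
Qed.

(** A small error at the midpoint nearly fixes [Y ^ 2]. With the branch relation each sign of [Y]
    then nearly fixes [b] and [g], and in all four cases the error at 1/4 exceeds [e]. *)
Lemma spurious_branches_error (b g z x : R) (e := 64 / 10 ^ 6)
    (p := quartic_patch c_ico (1 - q5 / 5 * b) b g z x) :
  b = (15 - 3 * q5) / 8 \/ g + (5 - q5) / 15 * b - (5 - q5) / 4 = 0 ->
  Rabs (enorm (p (1 / 2) 0) ^ 2 - 1) < e ->
  Rabs (enorm (p (1 / 4) 0) ^ 2 - 1) < e -> False.
Proof.
intros Hbranch H2 H4; assert (Hq := q5_bounds); assert (Hq2 := q5_sqr).
unfold p in H2, H4; rewrite edge_error in H2, H4.
apply Rabs_def2 in H2, H4; unfold e in *.
set (Y := 5 + 4 * (1 - q5 / 5) * b + 6 * g).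
replace (weight _ _ _ _ _ (1 - 1 / 2) _ _) with (Y / 16) in H2
  by (unfold Y, weight; field).
replace (weight _ _ _ _ _ (1 / 2) _ _) with (Y / 16) in H2
  by (unfold Y, weight; field).
set (P := weight _ _ _ _ _ (1 / 4) _ _) in H4.
set (Q := weight _ _ _ _ _ (1 - 1 / 4) _ _) in H4.
assert (EP : P = (1 + 12 * (1 - q5 / 5 * b) + 54 * g + 108 * b) / 256)
  by (unfold P, weight; field).
assert (EQ : Q = (81 + 108 * (1 - q5 / 5 * b) + 54 * g + 12 * b) / 256)
  by (unfold Q, weight; field).
assert (EY : Y = 5 + 4 * (1 - q5 / 5) * b + 6 * g) by reflexivity.
clearbody P Q Y.
assert (HY2 : 884353 / 10000 < Y ^ 2 < 88454 / 1000).
{ assert (E : (Y / 16) ^ 2 + (Y / 16) ^ 2 + 2 * q5 / 5 * (Y / 16 * (Y / 16)) =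
    (2 + 2 * q5 / 5) / 256 * Y ^ 2) by field.
  rewrite E in H2; split; nra. }
assert (HY : 9404 / 1000 < Y < 9405 / 1000 \/ - 9405 / 1000 < Y < - 9404 / 1000).
{ rewrite <- pow2_abs in HY2; assert (H0 := Rabs_pos Y).
  assert (HA : 9404 / 1000 < Rabs Y < 9405 / 1000).
  { split; apply Rnot_le_lt; intro H.
    - assert (Rabs Y ^ 2 <= (9404 / 1000) ^ 2) by (apply pow_incr; lra); lra.
    - assert ((9405 / 1000) ^ 2 <= Rabs Y ^ 2) by (apply pow_incr; lra); lra. }
  destruct (Rle_lt_dec 0 Y) as [H|H];
    [rewrite Rabs_pos_eq in HA by exact H | rewrite Rabs_left in HA by exact H];
    [left|right]; lra. }
clear H2 HY2.
assert (K : 89442 / 10 ^ 5 < 2 * q5 / 5 < 89443 / 10 ^ 5) by lra.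
set (k := 2 * q5 / 5) in *.
destruct Hbranch as [Hb|Hl].
- rewrite Hb in EP, EQ, EY; destruct HY as [HY|HY].
  + assert (HP : 540 / 1000 < P) by lra.
    assert (HQ : 665 / 1000 < Q) by lra.
    clear - H4 K HP HQ.
    assert (359 / 1000 < P * Q) by nra.
    assert (321 / 1000 < k * (P * Q)) by nra.
    assert (291 / 1000 < P ^ 2) by nra.
    assert (442 / 1000 < Q ^ 2) by nra.
    lra.
  + assert (HP : - 121 / 1000 < P < - 120 / 1000) by lra.
    assert (HQ : 0 < Q < 1 / 100) by lra.
    clear - H4 K HP HQ.
    assert (P * Q < 0) by nra.
    assert (k * (P * Q) < 0) by nra.
    assert (P ^ 2 < 2 / 100) by nra.
    assert (Q ^ 2 < 1 / 100) by nra.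
    lra.
- assert (Hg : g = (5 - q5) / 4 - (5 - q5) / 15 * b) by lra.
  assert (Ew : Y = (25 - 3 * q5) / 2 + (2 - 2 / 5 * q5) * b)
    by (rewrite EY, Hg; field).
  rewrite Hg in EP, EQ; destruct HY as [HY|HY].
  (* The tightest case: the squared norm at 1/4 is about 0.9994, so narrow enclosures are needed. *)
  + assert (Hb : 2334 / 10 ^ 4 < b < 2344 / 10 ^ 4) by (split; nra).
    assert (Hqb : 2236067977 / 10 ^ 9 * b <= q5 * b <= 2236067978 / 10 ^ 9 * b) by (split; nra).
    assert (HP : 28103 / 10 ^ 5 < P < 2814 / 10 ^ 4) by lra.
    assert (HQ : 84168 / 10 ^ 5 < Q < 84187 / 10 ^ 5) by lra.
    clear - H4 K HP HQ.
    assert (P ^ 2 < 791861 / 10 ^ 7) by nra.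
    assert (Q ^ 2 < 7087452 / 10 ^ 7) by nra.
    assert (0 < P * Q < 2369023 / 10 ^ 7) by nra.
    nra.
  + assert (Hb : - 168 / 10 < b < - 167 / 10) by (split; nra).
    assert (Hqb : 2236067978 / 10 ^ 9 * b <= q5 * b <= 2236067977 / 10 ^ 9 * b) by (split; nra).
    assert (HP : - 59 / 10 < P < - 58 / 10) by lra.
    assert (HQ : 39 / 10 < Q < 4) by lra.
    clear - H4 K HP HQ.
    assert (- 24 < P * Q < 0) by nra.
    assert (- 22 < k * (P * Q)) by nra.
    assert (33 < P ^ 2) by nra.
    assert (15 < Q ^ 2) by nra.
    lra.
Qed.

(** * Optimality *)

Lemma f1_bounds (g u v : R) :
  g_lo <= g <= g_hi ->
  (forall x, 0 <= x <= 1 / 2 -> peval (diag_sum g) x <= 0) ->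
  Defs.Delta u v -> mid g <= f1 u v g <= - mid g.
Proof.
intros Hg Hmax (Hu & Hv & Hw); rewrite f1_err.
set (w := 1 - u - v).
replace (u * v + (u + v) * w) with (u * v + v * w + w * u) by ring.
set (s := u * v + v * w + w * u); set (t := u * v * w).
assert (Hsum : u + v + w = 1) by (unfold w; ring).
assert (Hw0 : 0 <= w) by (unfold w; lra).
clearbody w.
assert (Huv : 0 <= u * v) by (apply Rmult_le_pos; lra).
assert (Hvw : 0 <= v * w) by (apply Rmult_le_pos; lra).
assert (Hwu : 0 <= w * u) by (apply Rmult_le_pos; lra).
assert (Ht : 0 <= t) by (apply Rmult_le_pos; lra).
assert (Hd : 1 - 3 * s = ((u - v) ^ 2 + (v - w) ^ 2 + (w - u) ^ 2) / 2).
{ unfold s; replace 1 with ((u + v + w) ^ 2) by (rewrite Hsum; ring); field. }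
assert (Ht3 : s ^ 2 - 3 * t =
  ((u * v - v * w) ^ 2 + (v * w - w * u) ^ 2 + (w * u - u * v) ^ 2) / 2).
{ replace (3 * t) with (3 * t * (u + v + w)) by (rewrite Hsum; ring).
  unfold s, t; field. }
assert (Hs : 0 <= s <= 1 / 3).
{ assert (X1 := pow2_ge_0 (u - v)); assert (X2 := pow2_ge_0 (v - w));
  assert (X3 := pow2_ge_0 (w - u)); unfold s in *; lra. }
assert (Hts : t <= s ^ 2 / 3).
{ assert (X1 := pow2_ge_0 (u * v - v * w)); assert (X2 := pow2_ge_0 (v * w - w * u));
  assert (X3 := pow2_ge_0 (w * u - u * v)); lra. }
(* The diagonal points with the same [s] have parameters [(1 - d) / 3] and [(1 + d) / 3], the roots
   of [r * (2 - 3 * r) = s]. *)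
set (d := sqrt (1 - 3 * s)).
assert (Hd0 : 0 <= d) by apply sqrt_pos.
assert (Hd2 : d ^ 2 = 1 - 3 * s)
  by (unfold d; rewrite <- Rsqr_pow2; apply Rsqr_sqrt; lra).
assert (Hd1 : d <= 1) by nra.
(* Places [w] between the values of [1 - 2 * r] for the two roots, which fixes the signs in
   [product_comparison]. *)
assert (Hw2 : (3 * w - 1) ^ 2 <= (2 * d) ^ 2).
{ replace ((2 * d) ^ 2) with (4 * d ^ 2) by ring; rewrite Hd2.
  rewrite Hd; replace (3 * w - 1) with (2 * w - u - v) by lra.
  assert (X := pow2_ge_0 (u - v)); nra. }
assert (Hwd : - (2 * d) <= 3 * w - 1 <= 2 * d)
  by (clear - Hw2 Hd0; split; apply Rnot_lt_le; intro; nra).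
split.
- apply err_lower; auto.
  intro H4; exists ((1 + d) / 3).
  assert (Hdh : d <= 1 / 2) by nra.
  assert (Es : s = (1 + d) / 3 * (2 - 3 * ((1 + d) / 3))) by lra.
  repeat split; try lra.
  assert (X := product_comparison u v w ((1 + d) / 3) Hsum Es).
  assert (0 <= (w - (1 + d) / 3) ^ 2 * (w - (1 - 2 * ((1 + d) / 3))))
    by (apply Rmult_le_pos; [apply pow2_ge_0|lra]).
  fold t in X; lra.
- apply err_upper; auto.
  exists ((1 - d) / 3).
  assert (Es : s = (1 - d) / 3 * (2 - 3 * ((1 - d) / 3))) by lra.
  repeat split; try lra.
  assert (X := product_comparison u v w ((1 - d) / 3) Hsum Es).
  assert (0 <= (w - (1 - d) / 3) ^ 2 * ((1 - 2 * ((1 - d) / 3)) - w))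
    by (apply Rmult_le_pos; [apply pow2_ge_0|lra]).
  fold t in X; lra.
Qed.

(** The two functions differ by [mid g], constant in [u]. *)
Lemma Derive_f1_diag (g u : R) :
  Derive (fun x => f1 x x g) u = peval (pderiv (diag_sum g)) u.
Proof.
rewrite pderiv_diag_sum; apply is_derive_unique.
apply (is_derive_ext (peval (diag 0 g))); [intro; symmetry; apply f1_diag|].
apply is_derive_peval.
Qed.

Lemma Derive_2_f1_diag (g u : R) :
  Derive_n (fun x => f1 x x g) 2 u = peval (pderiv (pderiv (diag_sum g))) u.
Proof.
apply is_derive_unique.
apply (is_derive_ext (peval (pderiv (diag_sum g)))); [|apply is_derive_peval].
intro; symmetry; apply Derive_f1_diag.
Qed.

Lemma diag_sum_f1 (g u : R) : peval (diag_sum g) u = f1 u u g + f1 (1 / 2) 0 g.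
Proof. rewrite peval_diag_sum, f1_diag, f1_mid; reflexivity. Qed.

Lemma family_error_lower_bound (g u g' : R) :
  g_lo <= g <= g_hi -> 3 / 25 <= u <= 4 / 25 -> peval (diag_sum g) u = 0 ->
  exists x y, Defs.Delta x y /\ - mid g <= Rabs (f1 x y g').
Proof.
intros Hg Hu H0; assert (Hq := q5_bounds).
destruct (diag_slope u Hu) as (a & b & E & H1 & H2).
(* Symmetric about [- 1 / 6], so [- 1 / 3 - g] is the mirror image of [g], and between the two the
   value is below the negative [mid g]. *)
assert (Em : forall g', f1 (1 / 2) 0 g' = (2 + 2 * q5 / 5) / 64 * (1 + 6 * g') ^ 2 - 1)
  by (intro; rewrite f1_mid; unfold mid, e20, e30; field).
unfold g_lo, g_hi in Hg.
destruct (Rlt_dec (- 1 / 3 - g) g') as [HA|HA];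
  [destruct (Rlt_dec g' g) as [HB|HB]|].
- exists (1 / 2), 0; split; [unfold Defs.Delta; lra|].
  rewrite <- f1_mid, <- Rabs_Ropp.
  apply Rle_trans with (2 := Rle_abs _); rewrite !Em.
  assert (0 <= (g - g') * (g + g' + 1 / 3)) by (apply Rmult_le_pos; lra).
  assert (X : 0 <= (2 + 2 * q5 / 5) / 64) by lra.
  nra.
- exists u, u; split; [unfold Defs.Delta; lra|].
  apply Rle_trans with (2 := Rle_abs _); rewrite f1_diag.
  rewrite peval_diag_sum in H0.
  rewrite E; rewrite E in H0.
  assert (0 <= (g' - g) * (a * (g + g') + b)); [|lra].
  apply Rmult_le_pos; nra.
- exists u, u; split; [unfold Defs.Delta; lra|].
  apply Rle_trans with (2 := Rle_abs _); rewrite f1_diag.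
  rewrite peval_diag_sum in H0.
  rewrite E; rewrite E in H0.
  assert (0 <= (g - g') * - (a * (g + g') + b)); [|lra].
  apply Rmult_le_pos; nra.
Qed.

(** * Numerical values of [gamma1] and [gamma2] *)

Lemma sqrt_between (a b x : R) :
  0 <= a -> 0 <= b -> a ^ 2 <= x <= b ^ 2 -> a <= sqrt x <= b.
Proof.
intros Ha Hb Hx; split.
- rewrite <- (sqrt_pow2 a Ha); apply sqrt_le_1_alt; lra.
- rewrite <- (sqrt_pow2 b Hb); apply sqrt_le_1_alt; lra.
Qed.

Lemma gamma1_bounds : 61701178 / 10 ^ 8 < gamma1 < 61701180 / 10 ^ 8.
Proof.
assert (Hq := q5_bounds).
destruct (sqrt_between (658911282 / 10 ^ 8) (658911283 / 10 ^ 8)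
  (6 * (5 + sqrt 5))); unfold gamma1; fold q5 in *; lra.
Qed.

Lemma gamma2_bounds : 61704700 / 10 ^ 8 < gamma2 < 61704701 / 10 ^ 8.
Proof.
assert (Hq := q5_bounds).
destruct (sqrt_between (2351141009 / 10 ^ 9) (2351141010 / 10 ^ 9)
  (10 - 2 * sqrt 5)); unfold gamma2; fold q5 in *; lra.
Qed.

Theorem mainTheorem7 :
  rounds_to 6 gamma1 (617012 / 10 ^ 6) /\
  rounds_to 6 gamma2 (617047 / 10 ^ 6) /\
  exists gamma_f1 u_star : R,
    (forall u g : R,
       admissible_solution u g <-> (u = u_star /\ g = gamma_f1)) /\
    rounds_to 6 gamma_f1 (617022 / 10 ^ 6) /\
    rounds_to 6 u_star (139979 / 10 ^ 6) /\
    G1_admissible c_ico (p_ico gamma_f1) /\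
    (forall alpha beta gamma zeta xi : R,
       G1_admissible c_ico (quartic_patch c_ico alpha beta gamma zeta xi) ->
       radial_error (p_ico gamma_f1) <=
       radial_error (quartic_patch c_ico alpha beta gamma zeta xi)).
Proof.
assert (G1 := gamma1_bounds); assert (G2 := gamma2_bounds).
split; [unfold rounds_to; apply Rabs_le; lra|].
split; [unfold rounds_to; apply Rabs_le; lra|].
destruct exists_critical_pair as (u & g & Hu & Hg' & H0 & Hmax).
assert (Hg : g_lo <= g <= g_hi) by lra.
assert (Hgn := Hg); unfold g_lo, g_hi in Hgn.
destruct (diag_sum_zero_location g u Hg Hmax Hu H0) as [Hloc Hcrit].
assert (Hfu : f1 u u g = - mid g) by (rewrite diag_sum_f1, f1_mid in H0; lra).
exists g, u; split; [|split; [|split; [|split]]].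
- intros u' g'; split.
  + intros ((E1 & _ & _) & Hgam & HD & Hbig).
    assert (H0' : peval (diag_sum g') u' = 0) by (rewrite diag_sum_f1; lra).
    assert (Hu' : 0 <= u' <= 1 / 2) by (unfold Defs.Delta in HD; lra).
    assert (Eg : g' = g).
    (* A smaller [g'] would be a root below the minimal one. For a larger [g'] the sum is positive
       at [u], so [f1 u u g'] exceeds the supposed maximum [f1 u' u' g']. *)
    { destruct (Rtotal_order g' g) as [H|[H|H]]; [exfalso|exact H|exfalso].
      - destruct (diag_sum_sign u' g' Hu') as (k & Hk & E); [lra|].
        destruct (diag_sum_sign u' g Hu') as (k' & Hk' & E'); [lra|].
        rewrite H0' in E; symmetry in E; apply Rmult_integral in E.
        assert (Hle := Hmax u' Hu'); nra.
      - destruct (diag_sum_sign u g' Hu) as (k & Hk & E); [lra|].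
        destruct (diag_sum_sign u g Hu) as (k' & Hk' & E'); [lra|].
        rewrite H0 in E'; symmetry in E'; apply Rmult_integral in E'.
        assert (Hle : f1 u u g' <= f1 u' u' g')
          by (apply Hbig; unfold Defs.Delta; lra).
        rewrite diag_sum_f1 in E, H0'; nra. }
    subst g'; split; [|reflexivity].
    exact (diag_sum_zero_unique g u u' Hg Hmax Hu H0 Hu' H0').
  + intros [-> ->].
    split; [split; [|split]|split; [|split]].
    * rewrite f1_mid; exact Hfu.
    * rewrite Derive_f1_diag; exact Hcrit.
    * rewrite Derive_2_f1_diag; apply diag_sum_second_derivative_neg; auto.
    * lra.
    * unfold Defs.Delta; lra.
    * intros x y H; rewrite Hfu; apply f1_bounds; auto.
- unfold rounds_to; apply Rabs_le; lra.
- exact (diag_sum_zero_enclosure g u Hg Hloc Hcrit).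
- exact (p_ico_G1_admissible g Hg).
- intros al b gam z x HG.
  apply (Rle_trans _ (- mid g)).
  { apply radial_error_le; intros y y' H.
    assert (X := f1_bounds g y y' Hg Hmax H); unfold f1 in X.
    apply Rabs_le; lra. }
  assert (Hge : forall y y', Defs.Delta y y' ->
    Rabs (enorm (quartic_patch c_ico al b gam z x y y') ^ 2 - 1)
      <= radial_error (quartic_patch c_ico al b gam z x))
    by (intros; apply radial_error_ge; auto using bounded_patch_error).
  destruct (G1_vertex_condition al b gam z x HG) as [-> Hb].
  destruct (G1_edge_conditions b gam z x HG Hb) as (E1 & E2 & E3).
  (* A patch better than [- mid g] would have errors below 64/10^6 at both edge points, which
     excludes the spurious branches and leaves the family. *)
  apply Rnot_lt_le; intro Hlt.
  assert (Hm : - mid g < 64 / 10 ^ 6) by (assert (X := coefficient_bounds g Hg); lra).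
  assert (Hspur : ~ (b = (15 - 3 * q5) / 8 \/
    gam + (5 - q5) / 15 * b - (5 - q5) / 4 = 0)).
  { intro Hbr; apply (spurious_branches_error b gam z x Hbr).
    - apply (Rle_lt_trans _ _ _ (Hge (1 / 2) 0 ltac:(unfold Defs.Delta; lra))); lra.
    - apply (Rle_lt_trans _ _ _ (Hge (1 / 4) 0 ltac:(unfold Defs.Delta; lra))); lra. }
  assert (Eb : b = be_ico gam).
  { assert (X := edge_determinant b gam z x E1 E2 E3).
    apply Rmult_integral in X; destruct X as [X|X]; [lra|].
    apply Rmult_integral in X; exfalso; apply Hspur; destruct X; [left|right]; lra. }
  subst b.
  destruct (edge_solution gam z x E1 E2) as [-> ->]; [tauto|].
  destruct (family_error_lower_bound g u gam Hg Hloc H0) as (y & y' & HD & Hlow).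
  specialize (Hge y y' HD).
  assert (Ep : quartic_patch c_ico (1 - q5 / 5 * be_ico gam) (be_ico gam) gam
      (ze_ico gam) (xi_ico gam) = p_ico gam).
  { unfold p_ico; destruct (ico_parameters gam) as (-> & -> & -> & ->).
    f_equal; assert (Hq := q5_sqr); unfold al_ico, be_ico.
    field_simplify_eq; ring [Hq]. }
  rewrite Ep in *; unfold f1 in Hlow; lra.
Qed.
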